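(* Let $E$ be a row-finite graph, and let $R$ be a commutative ring with unit $1\neq 0$. Then the following hold. (1) The map $H \mapsto I_H$ is a lattice isomorphism from the lattice of saturated hereditary subsets of $E^0$ onto the lattice of graded basic ideals of $L_R(E)$. In particular, the graded basic ideals of $L_R(E)$ form a lattice with $I_{H_1} \wedge I_{H_2} = I_{H_1 \cap H_2}$ and $I_{H_1} \vee I_{H_2} = I_{\overline{H_1 \cup H_2}}$ for any saturated hereditary subsets $H_1$ and $H_2$. (2) For any saturated hereditary subset $H$, the quotient $L_R(E)/I_H$ is canonically isomorphic to $L_R(E\setminus H)$. (3) For any hereditary subset $X$ of $E^0$, the ideal $I_X$ and the Leavitt path algebra $L_R(E_X)$ are Morita equivalent as rings.
   Context: Graphs: a graph is a directed graph $E=(E^0,E^1,r,s)$ with countable sets $E^0$ (vertices), $E^1$ (edges) and maps $r,s:E^1\to E^0$ (range, source). It is row-finite if $s^{-1}(v)$ is finite for every $v\in E^0$. A vertex $v$ is regular, $v\in E^0_{\mathrm{reg}}$, if $0<|s^{-1}(v)|<\infty$. A path of length $n\ge 1$ is $\alpha=e_1\cdots e_n$ with $e_i\in E^1$ and $r(e_i)=s(e_{i+1})$; put $|\alpha|=n$, $s(\alpha)=s(e_1)$, $r(\alpha)=r(e_n)$. Vertices are paths of length $0$. $E^*$ is the set of all finite paths. For formal symbols $e^*$ ($e\in E^1$) put $\alpha^*:=e_n^*\cdots e_1^*$ and $v^*:=v$. Rings are not assumed commutative or unital. For $R$ a commutative ring with unit $1$, an $R$-algebra is a ring $A$ that is also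 a left $R$-module with $\lambda(xy)=(\lambda x)y=x(\lambda y)$ and $1\cdot x=x$; homomorphisms of $R$-algebras are $R$-linear ring homomorphisms. A Leavitt $E$-family in a ring is a collection $\{v,e,e^*:v\in E^0,e\in E^1\}$ of elements such that the $v$'s are pairwise orthogonal idempotents and: (1) $s(e)e=er(e)=e$; (2) $r(e)e^*=e^*s(e)=e^*$; (3) $e^*f=\delta_{e,f}\,r(e)$ for all $e,f\in E^1$; (4) $v=\sum_{s(e)=v}ee^*$ for every $v\in E^0_{\mathrm{reg}}$. The Leavitt path algebra $L_R(E)$ is the universal $R$-algebra generated by a Leavitt $E$-family $\{v,e,e^*\}$: every Leavitt $E$-family $\{a_v,b_e,c_{e^*}\}$ in an $R$-algebra $A$ is the image of the generators under an $R$-algebra homomorphism $L_R(E)\to A$ with $v\mapsto a_v$, $e\mapsto b_e$, $e^*\mapsto c_{e^*}$. Ideals: ideals are two-sided. $L_R(E)$ is $\mathbb{Z}$-graded by $L_R(E)_k=\{\sum_{i=1}^N \lambda_i\alpha_i\beta_i^*:\alpha_i,\beta_i\in E^*,\lambda_i\in R,|\alpha_i|-|\beta_i|=k\text{ for all }i\}$; an ideal $I$ is graded if $I=\bigoplus_{k\in\mathbb{Z}}(I\cap L_R(E)_k)$. An ideal $I$ of $L_R(E)$ is basic if whenever $\lambda\in R\setminus\{0\}$, $v\in E^0$ and $\lambda v\in I$, then $v\in I$. Ideals are ordered by inclusion, with $I\wedge J=I\cap J$ and $I\vee J=I+J$. A subset $H\subseteq E^0$ is hereditary if $e\in E^1$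 and $s(e)\in H$ imply $r(e)\in H$. A hereditary $H$ is saturated if $v\in E^0_{\mathrm{reg}}$ and $r(s^{-1}(v))\subseteq H$ imply $v\in H$. For a hereditary set $X$, $\overline{X}$ is the smallest saturated hereditary subset of $E^0$ containing $X$. Saturated hereditary subsets are ordered by inclusion and form a lattice with $H_1\wedge H_2=H_1\cap H_2$, $H_1\vee H_2=\overline{H_1\cup H_2}$. For a hereditary set $X$, $I_X$ is the two-sided ideal of $L_R(E)$ generated by $\{v:v\in X\}$. For $H$ saturated hereditary, $E\setminus H$ is the graph with vertices $E^0\setminus H$ and edges $E^1\setminus r^{-1}(H)$, with range and source maps restricted from $E$. For $X$ hereditary, $E_X$ is the graph with vertices $X$ and edges $s^{-1}(X)$, with range and source maps restricted from $E$. In (2), canonically isomorphic means isomorphic as $R$-algebras via $v\mapsto v+I_H$, $e\mapsto e+I_H$, $e^*\mapsto e^*+I_H$ on the generators of $L_R(E\setminus H)$. Morita equivalence: a ring $T$ is idempotent if $T^2=T$, i.e. every element is a finite sum of products $a_kb_k$ with $a_k,b_k\in T$. For idempotent rings $T$ and $S$, a (surjective) Morita context $(T,S,M,N,\psi,\phi)$ consists of bimodules ${}_TM_S$ and ${}_SN_T$ that are unital ($TM=M$, $MS=M$, $SN=N$, $NT=N$), a surjective $T$-module homomorphism $\psi:M\otimes_S N\to T$ and a surjective $S$-module homomorphism $\phi:N\otimes_T M\to S$ with $\phi(n\otimes m)n'=n\,\psi(m\otimes n')$ and $m'\phi(n\otimes m)=\psi(m'\otimes n)m$ for all $m,m'\in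 M$, $n,n'\in N$. $T$ and $S$ are Morita equivalent if a Morita context exists. *)

(* Defs.v *)
From HB Require Import structures.
From mathcomp Require Import all_boot all_order all_algebra.
From mathcomp Require Import all_classical.

Set Implicit Arguments.
Unset Strict Implicit.
Unset Printing Implicit Defensive.

Import GRing.Theory.
Local Open Scope ring_scope.
Local Open Scope classical_set_scope.
Local Open Scope quotient_scope.

Reserved Notation "x ** y" (at level 40, left associativity).

(* nu: not necessarily unital. *)
HB.mixin Record Zmodule_isNuRing A of GRing.Zmodule A := {
  numul : A -> A -> A;
  numulA : associative numul;
  numulDl : left_distributive numul +%R;
  numulDr : right_distributive numul +%R
}.

#[short(type="nuRingType")]
HB.structure Definition NuRing := {A of Zmodule_isNuRing A & GRing.Zmodule A}.

Notation "x ** y" := (numul x y) : ring_scope.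

HB.mixin Record NuRing_Lmodule_isNuAlg (R : comPzRingType) A
    of NuRing A & GRing.Lmodule R A := {
  nuscaleAl : forall (a : R) (x y : A), a *: (x ** y) = (a *: x) ** y;
  nuscaleAr : forall (a : R) (x y : A), a *: (x ** y) = x ** (a *: y)
}.

#[short(type="nuAlgType")]
HB.structure Definition NuAlg (R : comPzRingType) :=
  {A of NuRing_Lmodule_isNuAlg R A & NuRing A & GRing.Lmodule R A}.

Definition nualg_hom (R : comPzRingType) (A B : nuAlgType R) (f : A -> B) :=
  linear f /\ {morph f : x y / x ** y}.

Lemma numul0r (A : nuRingType) (x : A) : 0 ** x = 0.
Proof. by apply: (addrI (0 ** x)); rewrite -numulDl !addr0. Qed.

Lemma numulr0 (A : nuRingType) (x : A) : x ** 0 = 0.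
Proof. by apply: (addrI (x ** 0)); rewrite -numulDr !addr0. Qed.

Lemma numulNr (A : nuRingType) (x y : A) : (- x) ** y = - (x ** y).
Proof. by apply: (addrI (x ** y)); rewrite -numulDl !subrr numul0r. Qed.

Lemma numulrN (A : nuRingType) (x y : A) : x ** (- y) = - (x ** y).
Proof. by apply: (addrI (x ** y)); rewrite -numulDr !subrr numulr0. Qed.

Definition is_ideal (A : nuRingType) (I : set A) : Prop :=
  [/\ I 0, forall x y, I x -> I y -> I (x - y),
      forall a x, I x -> I (a ** x) & forall x a, I x -> I (x ** a)].

Record ideal (A : nuRingType) :=
  Ideal { ideal_set :> set A; idealP : is_ideal ideal_set }.

Lemma is_ideal_smallest (A : nuRingType) (X : set A) :
  is_ideal (smallest (@is_ideal A) X).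
Proof.
split=> [J [[]] //|x y Ix Iy J JP|a x Ix J JP|x a Ix J JP].
- by have [[_ JB _ _] _] := JP; apply: JB; [exact: (Ix J JP)|exact: (Iy J JP)].
- by have [[_ _ Jl _] _] := JP; exact: (Jl _ _ (Ix J JP)).
- by have [[_ _ _ Jr] _] := JP; exact: (Jr _ _ (Ix J JP)).
Qed.

Section IdealRing.
Variables (A : nuRingType) (I : ideal A).

Lemma idealD x y : ideal_set I x -> ideal_set I y -> ideal_set I (x + y).
Proof.
have [I0 IB _ _] := idealP I.
by move=> Ix Iy; rewrite -[y]opprK -[- y]sub0r; do 2!apply: (IB) => //.
Qed.

Definition ideal_pred : {pred A} := fun x => `[< ideal_set I x >].

Lemma ideal_predP x : reflect (ideal_set I x) (x \in ideal_pred).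
Proof. exact: asboolP. Qed.

Lemma ideal_addumagma_closed : GRing.addumagma_closed ideal_pred.
Proof.
split; first by apply/ideal_predP; case: (idealP I).
by move=> x y /ideal_predP Ix /ideal_predP Iy; apply/ideal_predP/idealD.
Qed.

Lemma ideal_oppr_closed : GRing.oppr_closed ideal_pred.
Proof.
have [I0 IB _ _] := idealP I.
by move=> x /ideal_predP Ix; apply/ideal_predP; rewrite -sub0r; apply: IB.
Qed.

HB.instance Definition _ :=
  GRing.isAddClosed.Build A ideal_pred ideal_addumagma_closed.
HB.instance Definition _ :=
  GRing.isOppClosed.Build A ideal_pred ideal_oppr_closed.

Record ideal_ring := IdealRing {
  ideal_val : A;
  ideal_valP : ideal_val \in ideal_pred
}.

HB.instance Definition _ := [isSub for ideal_val].
HB.instance Definition _ := [Choice of ideal_ring by <:].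
HB.instance Definition _ := [SubChoice_isSubZmodule of ideal_ring by <:].

Lemma ideal_ring_mulP (x y : ideal_ring) :
  ideal_val x ** ideal_val y \in ideal_pred.
Proof.
have [_ _ _ Ir] := idealP I.
by case: x => x /= /ideal_predP xI; apply/ideal_predP/Ir.
Qed.

Definition ideal_ring_mul (x y : ideal_ring) : ideal_ring :=
  IdealRing (ideal_ring_mulP x y).

Lemma ideal_ring_mulA : associative ideal_ring_mul.
Proof. by move=> x y z; apply/val_inj/numulA. Qed.
Lemma ideal_ring_mulDl : left_distributive ideal_ring_mul +%R.
Proof. by move=> x y z; apply/val_inj/numulDl. Qed.
Lemma ideal_ring_mulDr : right_distributive ideal_ring_mul +%R.
Proof. by move=> x y z; apply/val_inj/numulDr. Qed.

HB.instance Definition _ := Zmodule_isNuRing.Build ideal_ring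
  ideal_ring_mulA ideal_ring_mulDl ideal_ring_mulDr.

End IdealRing.

Section QuotientRing.
Variables (A : nuRingType) (I : ideal A).

Definition ideal_rel : rel A := fun x y => x - y \in ideal_set I.

Lemma ideal_relP x y : reflect (ideal_set I (x - y)) (ideal_rel x y).
Proof. by apply: (iffP idP) => [/set_mem|/mem_set]. Qed.

Lemma ideal_rel_refl : reflexive ideal_rel.
Proof. by move=> x; apply/ideal_relP; rewrite subrr; case: (idealP I). Qed.

Lemma ideal_rel_sym : symmetric ideal_rel.
Proof.
have [I0 IB _ _] := idealP I.
by move=> x y; apply/ideal_relP/ideal_relP => h; rewrite -opprB -sub0r; apply: IB.
Qed.

Lemma ideal_rel_trans : transitive ideal_rel.
Proof.
move=> y x z /ideal_relP xy /ideal_relP yz; apply/ideal_relP.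
by rewrite -(subrKA y); apply: idealD.
Qed.

Canonical ideal_equiv :=
  EquivRel ideal_rel ideal_rel_refl ideal_rel_sym ideal_rel_trans.

Definition quot_ring := {eq_quot ideal_equiv}.
HB.instance Definition _ := Choice.on quot_ring.
HB.instance Definition _ := EqQuotient.on quot_ring.

Definition quot_pi (x : A) : quot_ring := \pi_quot_ring x.

Lemma quot_piP x y : quot_pi x = quot_pi y <-> ideal_set I (x - y).
Proof.
by split=> [/eqmodP/ideal_relP //|xy]; apply/eqmodP/ideal_relP.
Qed.

Lemma quot_repr x : ideal_set I (repr (quot_pi x) - x).
Proof. by apply/quot_piP; rewrite /quot_pi reprK. Qed.

Lemma quot_ind (P : quot_ring -> Prop) :
  (forall x, P (quot_pi x)) -> forall q, P q.
Proof. by move=> h q; have := h (repr q); rewrite /quot_pi reprK. Qed.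

Definition quot_opp (p : quot_ring) := quot_pi (- repr p).
Definition quot_add (p q : quot_ring) := quot_pi (repr p + repr q).
Definition quot_mul (p q : quot_ring) := quot_pi (repr p ** repr q).

Lemma quot_oppE x : quot_opp (quot_pi x) = quot_pi (- x).
Proof.
apply/quot_piP; have [I0 IB _ _] := idealP I.
by rewrite -opprD -sub0r; apply/IB/quot_repr.
Qed.

Lemma quot_addE x y : quot_add (quot_pi x) (quot_pi y) = quot_pi (x + y).
Proof. by apply/quot_piP; rewrite opprD addrACA; apply: idealD; apply: quot_repr. Qed.

Lemma quot_mulE x y : quot_mul (quot_pi x) (quot_pi y) = quot_pi (x ** y).
Proof.
apply/quot_piP; have [_ _ Il Ir] := idealP I.
rewrite -(subrKA (x ** repr (quot_pi y))) -[- (x ** repr _)]numulNr -numulDl.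
rewrite -numulrN -numulDr.
by apply: idealD; [apply: Ir|apply: Il]; apply: quot_repr.
Qed.

Lemma quot_addA : associative quot_add.
Proof. by do 3!elim/quot_ind=> ?; rewrite !quot_addE addrA. Qed.
Lemma quot_addC : commutative quot_add.
Proof. by do 2!elim/quot_ind=> ?; rewrite !quot_addE addrC. Qed.
Lemma quot_add0 : left_id (quot_pi 0) quot_add.
Proof. by elim/quot_ind=> ?; rewrite !quot_addE add0r. Qed.
Lemma quot_addN : left_inverse (quot_pi 0) quot_opp quot_add.
Proof. by elim/quot_ind=> ?; rewrite quot_oppE quot_addE addNr. Qed.

HB.instance Definition _ := GRing.isZmodule.Build quot_ring
  quot_addA quot_addC quot_add0 quot_addN.

Lemma quot_mulA : associative quot_mul.
Proof. by do 3!elim/quot_ind=> ?; rewrite !quot_mulE numulA. Qed.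
Lemma quot_mulDl : left_distributive quot_mul +%R.
Proof.
by do 3!elim/quot_ind=> ?; rewrite [_ + _]quot_addE !quot_mulE numulDl -quot_addE.
Qed.
Lemma quot_mulDr : right_distributive quot_mul +%R.
Proof.
by do 3!elim/quot_ind=> ?; rewrite [_ + _]quot_addE !quot_mulE numulDr -quot_addE.
Qed.

HB.instance Definition _ := Zmodule_isNuRing.Build quot_ring
  quot_mulA quot_mulDl quot_mulDr.

End QuotientRing.

Record graph := Graph {
  vert : countType;
  edge : countType;
  src : edge -> vert;
  rng : edge -> vert
}.

Section GraphTheory.
Variable E : graph.
Implicit Types (v : vert E) (e f : edge E) (H X : set (vert E)).

Definition out_edges v : set (edge E) := [set e | src e = v].

Definition row_finite := forall v, finite_set (out_edges v).

Definition regular v := out_edges v !=set0 /\ finite_set (out_edges v).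

Definition hereditary H := forall e, H (src e) -> H (rng e).

Definition saturated_hereditary H :=
  hereditary H /\
  forall v, regular v -> @rng E @` out_edges v `<=` H -> H v.

Definition saturation X : set (vert E) := smallest saturated_hereditary X.

Fixpoint walk v (p : seq (edge E)) : bool :=
  if p is e :: p' then (src e == v) && walk (rng e) p' else true.

(* The paths of length 0 are the vertices, so a path records its source. *)
Record gpath := GPath {
  gpath_src : vert E;
  gpath_edges : seq (edge E);
  gpath_walk : walk gpath_src gpath_edges
}.

Definition gpath_length (p : gpath) : nat := size (gpath_edges p).

End GraphTheory.

Section Subgraphs.
Variables (E : graph) (H : set (vert E)) (hH : hereditary H).

Lemma remove_src_subproof (e : {e : edge E | rng e \in ~` H}) :
  src (val e) \in ~` H.
Proof.
by case: e => e /= /set_mem re; apply/mem_set => se; apply/re/hH.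
Qed.

Definition graph_remove : graph := @Graph
  {v : vert E | v \in ~` H} {e : edge E | rng e \in ~` H}
  (fun e => exist _ (src (val e)) (remove_src_subproof e))
  (fun e => exist _ (rng (val e)) (valP e)).

Lemma restrict_rng_subproof (e : {e : edge E | src e \in H}) :
  rng (val e) \in H.
Proof. by case: e => e /= /set_mem se; apply/mem_set/hH. Qed.

Definition graph_restrict : graph := @Graph
  {v : vert E | v \in H} {e : edge E | src e \in H}
  (fun e => exist _ (src (val e)) (valP e))
  (fun e => exist _ (rng (val e)) (restrict_rng_subproof e)).

End Subgraphs.

Definition is_leavitt_family (E : graph) (A : nuRingType)
    (p : vert E -> A) (q qs : edge E -> A) : Prop :=
  [/\ forall v w, p v ** p w = if v == w then p v else 0,
      forall e, p (src e) ** q e = q e /\ q e ** p (rng e) = q e,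
      forall e, p (rng e) ** qs e = qs e /\ qs e ** p (src e) = qs e,
      forall e f, qs e ** q f = if e == f then p (rng e) else 0
    & forall v, regular v -> p v = \sum_(e \in out_edges v) q e ** qs e].

Record leavitt_family (E : graph) (A : nuRingType) := LeavittFamily {
  fam_vert : vert E -> A;
  fam_edge : edge E -> A;
  fam_ghost : edge E -> A;
  leavitt_familyP : is_leavitt_family fam_vert fam_edge fam_ghost
}.

(* L_R(E) is the quotient of the formal expressions in the generators by the
   identities that hold for every Leavitt E-family in every R-algebra. *)
Inductive lterm (R E0 E1 : Type) : Type :=
| LVert of E0
| LEdge of E1
| LGhost of E1
| LZero
| LOpp of lterm R E0 E1
| LAdd of lterm R E0 E1 & lterm R E0 E1
| LScale of R & lterm R E0 E1
| LMul of lterm R E0 E1 & lterm R E0 E1.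
Arguments LVert {R E0 E1}.
Arguments LEdge {R E0 E1}.
Arguments LGhost {R E0 E1}.
Arguments LZero {R E0 E1}.

HB.instance Definition _ R E0 E1 := gen_eqMixin (lterm R E0 E1).
HB.instance Definition _ R E0 E1 := gen_choiceMixin (lterm R E0 E1).

Section Leavitt.
Variables (R : comPzRingType) (E : graph).

Local Notation term := (lterm R (vert E) (edge E)).

Section Eval.
Variables (A : nuAlgType R) (F : leavitt_family E A).

Fixpoint lterm_eval (t : term) : A :=
  match t with
  | LVert v => fam_vert F v
  | LEdge e => fam_edge F e
  | LGhost e => fam_ghost F e
  | LZero => 0
  | LOpp t => - lterm_eval t
  | LAdd t u => lterm_eval t + lterm_eval u
  | LScale a t => a *: lterm_eval t
  | LMul t u => lterm_eval t ** lterm_eval u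
  end.

End Eval.

Definition lterm_eqv (t u : term) : Prop :=
  forall (A : nuAlgType R) (F : leavitt_family E A),
    lterm_eval F t = lterm_eval F u.

Definition lterm_rel : rel term := fun t u => `[< lterm_eqv t u >].

Lemma lterm_rel_refl : reflexive lterm_rel.
Proof. by move=> t; apply/asboolP. Qed.

Lemma lterm_rel_sym : symmetric lterm_rel.
Proof. by move=> t u; apply/asboolP/asboolP => h A F; rewrite h. Qed.

Lemma lterm_rel_trans : transitive lterm_rel.
Proof.
by move=> t s u /asboolP st /asboolP tu; apply/asboolP => A F; rewrite st.
Qed.

Canonical lterm_equiv :=
  EquivRel lterm_rel lterm_rel_refl lterm_rel_sym lterm_rel_trans.

Definition leavitt := {eq_quot lterm_equiv}.
HB.instance Definition _ := Choice.on leavitt.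
HB.instance Definition _ := EqQuotient.on leavitt.

Local Notation cl := (\pi_leavitt).

Lemma leavitt_piP t u : cl t = cl u <-> lterm_eqv t u.
Proof. by split=> [/eqmodP/asboolP|h]; last exact/eqmodP/asboolP. Qed.

Lemma leavitt_repr t : lterm_eqv (repr (cl t)) t.
Proof. by apply/leavitt_piP; rewrite reprK. Qed.

Lemma leavitt_pi_ind (P : leavitt -> Prop) : (forall t, P (cl t)) -> forall x, P x.
Proof. by move=> h x; have := h (repr x); rewrite reprK. Qed.

Definition leavitt_opp (x : leavitt) : leavitt := cl (LOpp (repr x)).
Definition leavitt_add (x y : leavitt) : leavitt := cl (LAdd (repr x) (repr y)).
Definition leavitt_scale (a : R) (x : leavitt) : leavitt := cl (LScale a (repr x)).
Definition leavitt_mul (x y : leavitt) : leavitt := cl (LMul (repr x) (repr y)).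

Lemma leavitt_oppE t : leavitt_opp (cl t) = cl (LOpp t).
Proof. by apply/leavitt_piP => A F /=; rewrite leavitt_repr. Qed.
Lemma leavitt_addE t u : leavitt_add (cl t) (cl u) = cl (LAdd t u).
Proof. by apply/leavitt_piP => A F /=; rewrite !leavitt_repr. Qed.
Lemma leavitt_scaleE a t : leavitt_scale a (cl t) = cl (LScale a t).
Proof. by apply/leavitt_piP => A F /=; rewrite leavitt_repr. Qed.
Lemma leavitt_mulE t u : leavitt_mul (cl t) (cl u) = cl (LMul t u).
Proof. by apply/leavitt_piP => A F /=; rewrite !leavitt_repr. Qed.

Let E_ := (leavitt_oppE, leavitt_addE, leavitt_scaleE, leavitt_mulE).

Lemma leavitt_addA : associative leavitt_add.
Proof.
by do 3!elim/leavitt_pi_ind=> ?; rewrite !E_; apply/leavitt_piP => A F; apply: addrA.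
Qed.
Lemma leavitt_addC : commutative leavitt_add.
Proof.
by do 2!elim/leavitt_pi_ind=> ?; rewrite !E_; apply/leavitt_piP => A F; apply: addrC.
Qed.
Lemma leavitt_add0 : left_id (cl LZero) leavitt_add.
Proof.
by elim/leavitt_pi_ind=> ?; rewrite !E_; apply/leavitt_piP => A F; apply: add0r.
Qed.
Lemma leavitt_addN : left_inverse (cl LZero) leavitt_opp leavitt_add.
Proof.
by elim/leavitt_pi_ind=> ?; rewrite !E_; apply/leavitt_piP => A F; apply: addNr.
Qed.

HB.instance Definition _ := GRing.isZmodule.Build leavitt
  leavitt_addA leavitt_addC leavitt_add0 leavitt_addN.

Lemma leavitt_scaleA a b x :
  leavitt_scale a (leavitt_scale b x) = leavitt_scale (a * b) x.
Proof.
elim/leavitt_pi_ind: x => ?; rewrite !E_.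
by apply/leavitt_piP => A F; apply: scalerA.
Qed.
Lemma leavitt_scale1 : left_id 1 leavitt_scale.
Proof.
elim/leavitt_pi_ind=> ?; rewrite !E_.
by apply/leavitt_piP => A F; apply: scale1r.
Qed.
Lemma leavitt_scaleDr : right_distributive leavitt_scale +%R.
Proof.
move=> a; do 2!elim/leavitt_pi_ind=> ?; rewrite [X in leavitt_scale _ X]leavitt_addE !E_.
by rewrite [RHS]leavitt_addE; apply/leavitt_piP => A F; apply: scalerDr.
Qed.
Lemma leavitt_scaleDl x : {morph leavitt_scale^~ x : a b / a + b}.
Proof.
move=> a b; elim/leavitt_pi_ind: x => ?; rewrite !E_ [RHS]leavitt_addE.
by apply/leavitt_piP => A F; apply: scalerDl.
Qed.

HB.instance Definition _ := GRing.Zmodule_isLmodule.Build R leavitt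
  leavitt_scaleA leavitt_scale1 leavitt_scaleDr leavitt_scaleDl.

Lemma leavitt_mulA : associative leavitt_mul.
Proof.
by do 3!elim/leavitt_pi_ind=> ?; rewrite !E_; apply/leavitt_piP => A F; apply: numulA.
Qed.
Lemma leavitt_mulDl : left_distributive leavitt_mul +%R.
Proof.
do 3!elim/leavitt_pi_ind=> ?; rewrite [X in leavitt_mul X _]leavitt_addE !E_.
by rewrite [RHS]leavitt_addE; apply/leavitt_piP => A F; apply: numulDl.
Qed.
Lemma leavitt_mulDr : right_distributive leavitt_mul +%R.
Proof.
do 3!elim/leavitt_pi_ind=> ?; rewrite [X in leavitt_mul _ X]leavitt_addE !E_.
by rewrite [RHS]leavitt_addE; apply/leavitt_piP => A F; apply: numulDr.
Qed.

HB.instance Definition _ := Zmodule_isNuRing.Build leavitt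
  leavitt_mulA leavitt_mulDl leavitt_mulDr.

Lemma leavitt_scale_pi a t : a *: cl t = cl (LScale a t).
Proof. exact: leavitt_scaleE. Qed.
Lemma leavitt_mul_pi t u : cl t ** cl u = cl (LMul t u).
Proof. exact: leavitt_mulE. Qed.

Lemma leavitt_scaleAl a (x y : leavitt) : a *: (x ** y) = (a *: x) ** y.
Proof.
elim/leavitt_pi_ind: x => t; elim/leavitt_pi_ind: y => u.
rewrite leavitt_mul_pi !leavitt_scale_pi leavitt_mul_pi.
by apply/leavitt_piP => A F; apply: nuscaleAl.
Qed.
Lemma leavitt_scaleAr a (x y : leavitt) : a *: (x ** y) = x ** (a *: y).
Proof.
elim/leavitt_pi_ind: x => t; elim/leavitt_pi_ind: y => u.
rewrite leavitt_mul_pi !leavitt_scale_pi leavitt_mul_pi.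
by apply/leavitt_piP => A F; apply: nuscaleAr.
Qed.

HB.instance Definition _ := NuRing_Lmodule_isNuAlg.Build R leavitt
  leavitt_scaleAl leavitt_scaleAr.

Definition lvert (v : vert E) : leavitt := cl (LVert v).
Definition ledge (e : edge E) : leavitt := cl (LEdge e).
Definition lghost (e : edge E) : leavitt := cl (LGhost e).

Lemma leavitt_ind (P : leavitt -> Prop) :
  (forall v, P (lvert v)) -> (forall e, P (ledge e)) ->
  (forall e, P (lghost e)) -> P 0 ->
  (forall x, P x -> P (- x)) -> (forall x y, P x -> P y -> P (x + y)) ->
  (forall a x, P x -> P (a *: x)) -> (forall x y, P x -> P y -> P (x ** y)) ->
  forall x, P x.
Proof.
move=> Pv Pe Pg P0 PN PD PZ PM; elim/leavitt_pi_ind; elim=> //.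
- by move=> t Pt; rewrite -leavitt_oppE; apply: PN.
- by move=> t Pt u Pu; rewrite -leavitt_addE; apply: PD.
- by move=> a t Pt; rewrite -leavitt_scaleE; apply: PZ.
- by move=> t Pt u Pu; rewrite -leavitt_mulE; apply: PM.
Qed.

Definition leavitt_lift (A : nuAlgType R) (F : leavitt_family E A)
  (x : leavitt) : A := lterm_eval F (repr x).

Section Lift.
Variables (A : nuAlgType R) (F : leavitt_family E A).

Lemma leavitt_lift_pi t : leavitt_lift F (cl t) = lterm_eval F t.
Proof. exact: leavitt_repr. Qed.

Lemma leavitt_lift_vert v : leavitt_lift F (lvert v) = fam_vert F v.
Proof. exact: leavitt_lift_pi. Qed.
Lemma leavitt_lift_edge e : leavitt_lift F (ledge e) = fam_edge F e.
Proof. exact: leavitt_lift_pi. Qed.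
Lemma leavitt_lift_ghost e : leavitt_lift F (lghost e) = fam_ghost F e.
Proof. exact: leavitt_lift_pi. Qed.

Lemma leavitt_lift_hom : nualg_hom (leavitt_lift F).
Proof.
split=> [a|]; do 2!elim/leavitt_pi_ind=> ?; last first.
  by rewrite [_ ** _]leavitt_mulE !leavitt_lift_pi.
by rewrite [_ *: _]leavitt_scaleE [_ + _]leavitt_addE !leavitt_lift_pi.
Qed.

Lemma leavitt_lift_uniq (g : leavitt -> A) : nualg_hom g ->
  (forall v, g (lvert v) = fam_vert F v) ->
  (forall e, g (ledge e) = fam_edge F e) ->
  (forall e, g (lghost e) = fam_ghost F e) -> g =1 leavitt_lift F.
Proof.
move=> [gL gM] gv ge gg.
have [fL fM] := leavitt_lift_hom.
have lin0 (f : leavitt -> A) : linear f -> f 0 = 0.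
  by move=> fl; have := fl 1 0 0; rewrite !scale1r addr0 => h; apply: (addrI (f 0)); rewrite addr0 -h.
have linZ (f : leavitt -> A) a x : linear f -> f (a *: x) = a *: f x.
  by move=> fl; rewrite -[a *: x]addr0 fl lin0 ?addr0.
have linD (f : leavitt -> A) x y : linear f -> f (x + y) = f x + f y.
  by move=> fl; rewrite -[x in LHS]scale1r fl scale1r.
elim/leavitt_ind => [v|e|e||x h|x y hx hy|a x h|x y hx hy].
- by rewrite gv leavitt_lift_vert.
- by rewrite ge leavitt_lift_edge.
- by rewrite gg leavitt_lift_ghost.
- by rewrite !lin0.
- by rewrite -scaleN1r !linZ // h.
- by rewrite !linD // hx hy.
- by rewrite !linZ // h.
- by rewrite gM fM hx hy.
Qed.

End Lift.

Lemma leavitt_sum_pi (I : Type) (s : seq I) (t : I -> term) :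
  \sum_(i <- s) cl (t i) = cl (\big[@LAdd _ _ _/LZero]_(i <- s) t i).
Proof.
elim: s => [|i s IH]; first by rewrite !big_nil.
by rewrite !big_cons IH; apply: leavitt_addE.
Qed.

Lemma lterm_eval_sum (A : nuAlgType R) (F : leavitt_family E A)
    (I : Type) (s : seq I) (t : I -> term) :
  lterm_eval F (\big[@LAdd _ _ _/LZero]_(i <- s) t i) =
  \sum_(i <- s) lterm_eval F (t i).
Proof. by elim: s => [|i s IH]; rewrite ?big_nil // !big_cons /= IH. Qed.

Lemma leavitt_gen_family : is_leavitt_family lvert ledge lghost.
Proof.
rewrite /lvert /ledge /lghost.
split=> [v w|e|e|e f|v vreg]; rewrite ?leavitt_mul_pi.
- have [->|vw] := eqVneq v w; apply/leavitt_piP => A F /=;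
    have [h _ _ _ _] := leavitt_familyP F; first by rewrite h eqxx.
  by rewrite h (negPf vw).
- by split; apply/leavitt_piP => A F /=; have [_ /(_ e)[]] := leavitt_familyP F.
- by split; apply/leavitt_piP => A F /=; have [_ _ /(_ e)[]] := leavitt_familyP F.
- have [->|ef] := eqVneq e f; apply/leavitt_piP => A F /=;
    have [_ _ _ h _] := leavitt_familyP F; first by rewrite h eqxx.
  by rewrite h (negPf ef).
- have [_ vfin] := vreg; rewrite fsbig_finite //=.
  under eq_bigr do rewrite leavitt_mul_pi.
  rewrite leavitt_sum_pi; apply/leavitt_piP => A F; rewrite lterm_eval_sum /=.
  by have [_ _ _ _ /(_ v vreg)->] := leavitt_familyP F; rewrite fsbig_finite.
Qed.

Definition leavitt_gens : leavitt_family E leavitt :=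
  LeavittFamily leavitt_gen_family.

End Leavitt.

Arguments lvert R {E}.
Arguments ledge R {E}.
Arguments lghost R {E}.

Section LocalUnits.
Variables (R : comPzRingType) (E : graph).
Local Notation L := (leavitt R E).

Lemma numul_suml (A : nuRingType) (I : Type) (s : seq I) (f : I -> A) x :
  (\sum_(i <- s) f i) ** x = \sum_(i <- s) f i ** x.
Proof.
by elim: s => [|i s IH]; rewrite ?big_nil ?numul0r // !big_cons numulDl IH.
Qed.

Lemma leavitt_left_unit (x : L) : exists s : seq (vert E),
  forall s', uniq s' -> {subset s <= s'} -> (\sum_(v <- s') lvert R v) ** x = x.
Proof.
have [pp pe pg _ _] := leavitt_gen_family R E.
have base v (y : L) : lvert R v ** y = y -> exists s : seq (vert E),
    forall s', uniq s' -> {subset s <= s'} -> (\sum_(w <- s') lvert R w) ** y = y.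
  move=> vy; exists [:: v] => s' us' ss'.
  rewrite numul_suml (bigD1_seq v) //=; last by apply: ss'; rewrite inE.
  rewrite vy big1 ?addr0 // => w wv.
  by rewrite -vy numulA pp (negPf wv) numul0r.
elim/leavitt_ind: x => [v|e|e||x [s h]|x y [s h] [t k]|a x [s h]|x y [s h] _].
- by apply: (base v); rewrite pp eqxx.
- by apply: (base (src e)); case: (pe e).
- by apply: (base (rng e)); case: (pg e).
- by exists [::] => s' _ _; rewrite numulr0.
- by exists s => s' us ss; rewrite numulrN h.
- exists (s ++ t) => s' us ss; rewrite numulDr h ?k // => z zs; apply: ss.
    by rewrite mem_cat zs orbT.
  by rewrite mem_cat zs.
- by exists s => s' us ss; rewrite -nuscaleAr h.
- by exists s => s' us ss; rewrite numulA h.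
Qed.

Lemma leavitt_idealZ (I : ideal L) (a : R) x :
  ideal_set I x -> ideal_set I (a *: x).
Proof.
have [_ _ Il _] := idealP I; have [s h] := leavitt_left_unit x.
move=> Ix; rewrite -(h (undup s)) ?undup_uniq //; last by move=> v; rewrite mem_undup.
by rewrite nuscaleAl; apply: Il.
Qed.

End LocalUnits.

(* The R-module structure of the quotient uses that every ring ideal of
   L_R(E) is stable under scalars (leavitt_idealZ). *)
Section LeavittQuotient.
Variables (R : comPzRingType) (E : graph) (I : ideal (leavitt R E)).

Definition leavitt_quot := quot_ring I.
HB.instance Definition _ := NuRing.on leavitt_quot.

Definition leavitt_proj (x : leavitt R E) : leavitt_quot := quot_pi I x.

Lemma leavitt_quot_ind (P : leavitt_quot -> Prop) :
  (forall x, P (leavitt_proj x)) -> forall q, P q.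
Proof. exact: quot_ind. Qed.

Lemma leavitt_proj_add x y : leavitt_proj x + leavitt_proj y = leavitt_proj (x + y).
Proof. exact: quot_addE. Qed.
Lemma leavitt_proj_mul x y : leavitt_proj x ** leavitt_proj y = leavitt_proj (x ** y).
Proof. exact: quot_mulE. Qed.

Definition quot_scale (a : R) (q : leavitt_quot) : leavitt_quot :=
  leavitt_proj (a *: repr q).

Lemma quot_scaleE a x : quot_scale a (leavitt_proj x) = leavitt_proj (a *: x).
Proof.
apply/quot_piP; rewrite -scalerBr; apply: leavitt_idealZ; exact: quot_repr.
Qed.

Lemma quot_scaleA a b q : quot_scale a (quot_scale b q) = quot_scale (a * b) q.
Proof. by elim/leavitt_quot_ind: q => x; rewrite !quot_scaleE scalerA. Qed.
Lemma quot_scale1 : left_id 1 quot_scale.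
Proof. by elim/leavitt_quot_ind=> x; rewrite quot_scaleE scale1r. Qed.
Lemma quot_scaleDr : right_distributive quot_scale +%R.
Proof.
move=> a; elim/leavitt_quot_ind=> x; elim/leavitt_quot_ind=> y.
by rewrite leavitt_proj_add !quot_scaleE scalerDr leavitt_proj_add.
Qed.
Lemma quot_scaleDl q : {morph quot_scale^~ q : a b / a + b}.
Proof.
by move=> a b; elim/leavitt_quot_ind: q => x; rewrite !quot_scaleE scalerDl leavitt_proj_add.
Qed.

HB.instance Definition _ := GRing.Zmodule_isLmodule.Build R leavitt_quot
  quot_scaleA quot_scale1 quot_scaleDr quot_scaleDl.

Lemma leavitt_proj_scale a x : a *: leavitt_proj x = leavitt_proj (a *: x).
Proof. exact: quot_scaleE. Qed.

Lemma quot_scaleAl a (p q : leavitt_quot) : a *: (p ** q) = (a *: p) ** q.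
Proof.
elim/leavitt_quot_ind: p => x; elim/leavitt_quot_ind: q => y.
by rewrite leavitt_proj_mul !leavitt_proj_scale leavitt_proj_mul nuscaleAl.
Qed.
Lemma quot_scaleAr a (p q : leavitt_quot) : a *: (p ** q) = p ** (a *: q).
Proof.
elim/leavitt_quot_ind: p => x; elim/leavitt_quot_ind: q => y.
by rewrite leavitt_proj_mul !leavitt_proj_scale leavitt_proj_mul nuscaleAr.
Qed.

HB.instance Definition _ := NuRing_Lmodule_isNuAlg.Build R leavitt_quot
  quot_scaleAl quot_scaleAr.

End LeavittQuotient.

Section LeavittIdeals.
Variables (R : comPzRingType) (E : graph).
Local Notation L := (leavitt R E).

Definition path_elt (p : gpath E) : L :=
  if gpath_edges p is e :: es
  then foldl (fun x f => x ** ledge R f) (ledge R e) es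
  else lvert R (gpath_src p).

Definition path_star (p : gpath E) : L :=
  if gpath_edges p is e :: es
  then foldl (fun x f => lghost R f ** x) (lghost R e) es
  else lvert R (gpath_src p).

Definition leavitt_deg (k : int) : set L :=
  [set x | exists (N : nat) (lam : 'I_N -> R) (al be : 'I_N -> gpath E),
     (forall i, (gpath_length (al i))%:Z - (gpath_length (be i))%:Z = k) /\
     x = \sum_(i < N) lam i *: (path_elt (al i) ** path_star (be i))].

Definition direct_sum_of (A : zmodType) (V : int -> set A) (I : set A) : Prop :=
  (forall k, V k `<=` I) /\
  forall x, I x -> exists! f : int -> A,
    [/\ forall k, V k (f k), finite_set [set k | f k != 0]
      & x = \sum_(k \in setT) f k].

Definition graded (I : set L) : Prop :=
  direct_sum_of (fun k => I `&` leavitt_deg k) I.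

Definition basic (I : set L) : Prop :=
  forall (a : R) (v : vert E), a != 0 -> I (a *: lvert R v) -> I (lvert R v).

Definition graded_basic_ideal (I : set L) : Prop :=
  [/\ is_ideal I, graded I & basic I].

Definition vert_ideal (X : set (vert E)) : ideal L :=
  Ideal (is_ideal_smallest (@lvert R E @` X)).

Definition ideal_sum (I J : set L) : set L := [set x + y | x in I & y in J].

End LeavittIdeals.

Arguments vert_ideal R {E} X.

Definition set_lattice (T : Type) (P : set (set T))
    (meet join : set T -> set T -> set T) : Prop :=
  forall A B, P A -> P B ->
  [/\ P (meet A B), P (join A B),
      [/\ meet A B `<=` A, meet A B `<=` B
        & forall C, P C -> C `<=` A -> C `<=` B -> C `<=` meet A B]
    & [/\ A `<=` join A B, B `<=` join A B
        & forall C, P C -> A `<=` C -> B `<=` C -> join A B `<=` C]].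

Definition set_lattice_iso (T U : Type)
    (P : set (set T)) (meetP joinP : set T -> set T -> set T)
    (Q : set (set U)) (meetQ joinQ : set U -> set U -> set U)
    (f : set T -> set U) : Prop :=
  [/\ set_bij P Q f,
      forall A B, P A -> P B -> (A `<=` B <-> f A `<=` f B),
      forall A B, P A -> P B -> f (meetP A B) = meetQ (f A) (f B)
    & forall A B, P A -> P B -> f (joinP A B) = joinQ (f A) (f B)].

HB.mixin Record Zmodule_isBimod (T S : nuRingType) M of GRing.Zmodule M := {
  lact : T -> M -> M;
  ract : M -> S -> M;
  lactA : forall t u m, lact t (lact u m) = lact (t ** u) m;
  ractA : forall m s u, ract (ract m s) u = ract m (s ** u);
  lractA : forall t m s, lact t (ract m s) = ract (lact t m) s;
  lactDl : forall m, {morph lact^~ m : t u / t + u};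
  lactDr : forall t, {morph lact t : m n / m + n};
  ractDl : forall s, {morph ract^~ s : m n / m + n};
  ractDr : forall m, {morph ract m : s u / s + u}
}.

#[short(type="bimodType")]
HB.structure Definition Bimod (T S : nuRingType) :=
  {M of Zmodule_isBimod T S M & GRing.Zmodule M}.

Arguments lact {T S M} t m : rename.
Arguments ract {T S M} m s : rename.

Definition unital_bimod (T S : nuRingType) (M : bimodType T S) : Prop :=
  (forall m : M, exists s : seq (T * M), m = \sum_(p <- s) lact p.1 p.2) /\
  (forall m : M, exists s : seq (M * S), m = \sum_(p <- s) ract p.1 p.2).

(* The tensor product over S: formal sums of pairs, modulo the identities that
   hold for every biadditive S-balanced map to an abelian group. *)
Section Tensor.
Variables (T S U : nuRingType) (M : bimodType T S) (N : bimodType S U).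

Definition balanced (G : zmodType) (f : M -> N -> G) : Prop :=
  [/\ forall n, {morph f^~ n : m m' / m + m'},
      forall m, {morph f m : n n' / n + n'}
    & forall m s n, f (ract m s) n = f m (lact s n)].

Definition tens_eval (G : zmodType) (f : M -> N -> G) (x : seq (M * N)) : G :=
  \sum_(p <- x) f p.1 p.2.

Definition tens_eqv (x y : seq (M * N)) : Prop :=
  forall (G : zmodType) (f : M -> N -> G),
    balanced f -> tens_eval f x = tens_eval f y.

Definition tens_rel : rel (seq (M * N)) := fun x y => `[< tens_eqv x y >].

Lemma tens_rel_refl : reflexive tens_rel.
Proof. by move=> t; apply/asboolP. Qed.
Lemma tens_rel_sym : symmetric tens_rel.
Proof. by move=> t u; apply/asboolP/asboolP => h G f fb; rewrite h. Qed.
Lemma tens_rel_trans : transitive tens_rel.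
Proof.
by move=> t s u /asboolP st /asboolP tu; apply/asboolP => G f fb; rewrite st // tu.
Qed.

Canonical tens_equiv := EquivRel tens_rel tens_rel_refl tens_rel_sym tens_rel_trans.

Definition tensor := {eq_quot tens_equiv}.
HB.instance Definition _ := Choice.on tensor.
HB.instance Definition _ := EqQuotient.on tensor.

Local Notation cl := (\pi_tensor).

Lemma tensor_piP x y : cl x = cl y <-> tens_eqv x y.
Proof. by split=> [/eqmodP/asboolP|h]; last exact/eqmodP/asboolP. Qed.

Lemma tensor_repr x : tens_eqv (repr (cl x)) x.
Proof. by apply/tensor_piP; rewrite reprK. Qed.

Lemma tensor_pi_ind (P : tensor -> Prop) : (forall t, P (cl t)) -> forall x, P x.
Proof. by move=> h x; have := h (repr x); rewrite reprK. Qed.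

Lemma tens_eval_cat (G : zmodType) (f : M -> N -> G) x y :
  tens_eval f (x ++ y) = tens_eval f x + tens_eval f y.
Proof. exact: big_cat. Qed.

Lemma tens_eval_opp (G : zmodType) (f : M -> N -> G) x : balanced f ->
  tens_eval f [seq (- p.1, p.2) | p <- x] = - tens_eval f x.
Proof.
move=> [fl _ _]; rewrite /tens_eval big_map -sumrN; apply: eq_bigr => -[m n] _ /=.
have f0 : f 0 n = 0 by apply: (addIr (f 0 n)); rewrite -fl !add0r.
by apply: (addIr (f m n)); rewrite -fl !addNr f0.
Qed.

Lemma tens_eval_lact (G : zmodType) (f : M -> N -> G) t x :
  tens_eval f [seq (lact t p.1, p.2) | p <- x] =
  tens_eval (fun m n => f (lact t m) n) x.
Proof. exact: big_map. Qed.

Lemma tens_eval_ract (G : zmodType) (f : M -> N -> G) u x :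
  tens_eval f [seq (p.1, ract p.2 u) | p <- x] =
  tens_eval (fun m n => f m (ract n u)) x.
Proof. exact: big_map. Qed.

Lemma balanced_lact (G : zmodType) (f : M -> N -> G) t :
  balanced f -> balanced (fun m n => f (lact t m) n).
Proof.
move=> [fl fr fb]; split=> [n m m'|m n n'|m s n].
- by rewrite lactDr fl.
- by rewrite fr.
- by rewrite lractA fb.
Qed.

Lemma balanced_ract (G : zmodType) (f : M -> N -> G) u :
  balanced f -> balanced (fun m n => f m (ract n u)).
Proof.
move=> [fl fr fb]; split=> [n m m'|m n n'|m s n].
- by rewrite fl.
- by rewrite ractDl fr.
- by rewrite fb lractA.
Qed.

Definition tensor_opp (x : tensor) : tensor :=
  cl [seq (- p.1, p.2) | p <- repr x].
Definition tensor_add (x y : tensor) : tensor := cl (repr x ++ repr y).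
Definition tensor_lact (t : T) (x : tensor) : tensor :=
  cl [seq (lact t p.1, p.2) | p <- repr x].
Definition tensor_ract (x : tensor) (u : U) : tensor :=
  cl [seq (p.1, ract p.2 u) | p <- repr x].

Lemma tensor_oppE x : tensor_opp (cl x) = cl [seq (- p.1, p.2) | p <- x].
Proof. by apply/tensor_piP => G f fb; rewrite !tens_eval_opp // tensor_repr. Qed.
Lemma tensor_addE x y : tensor_add (cl x) (cl y) = cl (x ++ y).
Proof. by apply/tensor_piP => G f fb; rewrite !tens_eval_cat !tensor_repr. Qed.
Lemma tensor_lactE t x : tensor_lact t (cl x) = cl [seq (lact t p.1, p.2) | p <- x].
Proof.
apply/tensor_piP => G f fb; rewrite !tens_eval_lact.
exact/tensor_repr/balanced_lact.
Qed.
Lemma tensor_ractE u x : tensor_ract (cl x) u = cl [seq (p.1, ract p.2 u) | p <- x].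
Proof.
apply/tensor_piP => G f fb; rewrite !tens_eval_ract.
exact/tensor_repr/balanced_ract.
Qed.

Lemma tensor_addA : associative tensor_add.
Proof. by do 3!elim/tensor_pi_ind=> ?; rewrite !tensor_addE catA. Qed.
Lemma tensor_addC : commutative tensor_add.
Proof.
do 2!elim/tensor_pi_ind=> ?; rewrite !tensor_addE.
by apply/tensor_piP => G f fb; rewrite !tens_eval_cat addrC.
Qed.
Lemma tensor_add0 : left_id (cl [::]) tensor_add.
Proof. by elim/tensor_pi_ind=> ?; rewrite tensor_addE. Qed.
Lemma tensor_addN : left_inverse (cl [::]) tensor_opp tensor_add.
Proof.
elim/tensor_pi_ind=> ?; rewrite tensor_oppE tensor_addE.
apply/tensor_piP => G f fb; rewrite tens_eval_cat tens_eval_opp // addNr.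
by rewrite /tens_eval big_nil.
Qed.

HB.instance Definition _ := GRing.isZmodule.Build tensor
  tensor_addA tensor_addC tensor_add0 tensor_addN.

Lemma tensor_lactA t u x :
  tensor_lact t (tensor_lact u x) = tensor_lact (t ** u) x.
Proof.
elim/tensor_pi_ind: x => x; rewrite !tensor_lactE -map_comp; congr (cl _).
by apply: eq_map => p /=; rewrite lactA.
Qed.
Lemma tensor_ractA x t u :
  tensor_ract (tensor_ract x t) u = tensor_ract x (t ** u).
Proof.
elim/tensor_pi_ind: x => x; rewrite !tensor_ractE -map_comp; congr (cl _).
by apply: eq_map => p /=; rewrite ractA.
Qed.
Lemma tensor_lractA t x u :
  tensor_lact t (tensor_ract x u) = tensor_ract (tensor_lact t x) u.
Proof.
elim/tensor_pi_ind: x => x.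
by rewrite tensor_lactE !tensor_ractE tensor_lactE -!map_comp.
Qed.
Lemma tensor_lactDl x : {morph tensor_lact^~ x : t u / t + u}.
Proof.
move=> t u; elim/tensor_pi_ind: x => x; rewrite !tensor_lactE [RHS]tensor_addE.
apply/tensor_piP => G f [fl _ _]; rewrite tens_eval_cat !tens_eval_lact.
by rewrite -big_split; apply: eq_bigr => p _ /=; rewrite lactDl fl.
Qed.
Lemma tensor_lactDr t : {morph tensor_lact t : x y / x + y}.
Proof.
move=> x y; elim/tensor_pi_ind: x => x; elim/tensor_pi_ind: y => y.
by rewrite [_ + _]tensor_addE !tensor_lactE map_cat [RHS]tensor_addE.
Qed.
Lemma tensor_ractDl u : {morph tensor_ract^~ u : x y / x + y}.
Proof.
move=> x y; elim/tensor_pi_ind: x => x; elim/tensor_pi_ind: y => y.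
by rewrite [_ + _]tensor_addE !tensor_ractE map_cat [RHS]tensor_addE.
Qed.
Lemma tensor_ractDr x : {morph tensor_ract x : t u / t + u}.
Proof.
move=> t u; elim/tensor_pi_ind: x => x; rewrite !tensor_ractE [RHS]tensor_addE.
apply/tensor_piP => G f [_ fr _]; rewrite tens_eval_cat !tens_eval_ract.
by rewrite -big_split; apply: eq_bigr => p _ /=; rewrite ractDr fr.
Qed.

HB.instance Definition _ := Zmodule_isBimod.Build T U tensor
  tensor_lactA tensor_ractA tensor_lractA
  tensor_lactDl tensor_lactDr tensor_ractDl tensor_ractDr.

Definition tens (m : M) (n : N) : tensor := cl [:: (m, n)].

Lemma tens_balanced : balanced tens.
Proof.
split=> [n m m'|m n n'|m s n]; rewrite ?[RHS]tensor_addE;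
  apply/tensor_piP => G f [fl fr fb]; rewrite /tens_eval !big_cons !big_nil !addr0 /=.
- exact: fl.
- exact: fr.
- exact: fb.
Qed.

Lemma tensor_lift (G : zmodType) (f : M -> N -> G) : balanced f ->
  exists2 g : {additive tensor -> G}, forall m n, g (tens m n) = f m n
    & forall g' : {additive tensor -> G},
        (forall m n, g' (tens m n) = f m n) -> g' =1 g.
Proof.
move=> fb; pose g0 (x : tensor) := tens_eval f (repr x).
have g0E x : g0 (cl x) = tens_eval f x by apply: tensor_repr.
have g0D : zmod_morphism g0.
  move=> x y; elim/tensor_pi_ind: x => x; elim/tensor_pi_ind: y => y.
  by rewrite [- _]tensor_oppE [_ + _]tensor_addE !g0E tens_eval_cat tens_eval_opp.
pose gm := GRing.isZmodMorphism.Build tensor G g0 g0D.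
pose g : {additive tensor -> G} := HB.pack g0 gm.
exists g => [m n|g' g'E]; first by rewrite /g /= g0E /tens_eval big_seq1.
elim/tensor_pi_ind => x; rewrite [RHS]g0E.
elim: x => [|[m n] x IH]; first by rewrite /tens_eval big_nil [LHS]raddf0.
have -> : cl ((m, n) :: x) = tens m n + cl x by rewrite [RHS]tensor_addE.
by rewrite raddfD g'E IH /tens_eval big_cons.
Qed.

End Tensor.

Definition idempotent_ring (T : nuRingType) : Prop :=
  forall t : T, exists s : seq (T * T), t = \sum_(p <- s) p.1 ** p.2.

Record morita_context (T S : nuRingType) := MoritaContext {
  mc_M : bimodType T S;
  mc_N : bimodType S T;
  mc_psi : {additive tensor mc_M mc_N -> T};
  mc_phi : {additive tensor mc_N mc_M -> S};
  mc_unitalM : unital_bimod mc_M;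
  mc_unitalN : unital_bimod mc_N;
  mc_psi_lact : forall t x, mc_psi (lact t x) = t ** mc_psi x;
  mc_psi_ract : forall x t, mc_psi (ract x t) = mc_psi x ** t;
  mc_phi_lact : forall s x, mc_phi (lact s x) = s ** mc_phi x;
  mc_phi_ract : forall x s, mc_phi (ract x s) = mc_phi x ** s;
  mc_psi_surj : forall t, exists x, mc_psi x = t;
  mc_phi_surj : forall s, exists x, mc_phi x = s;
  mc_phi_psi : forall n m n',
    lact (mc_phi (tens n m)) n' = ract n (mc_psi (tens m n'));
  mc_psi_phi : forall m' n m,
    ract m' (mc_phi (tens n m)) = lact (mc_psi (tens m' n)) m
}.

Definition morita_equivalent (T S : nuRingType) : Prop :=
  [/\ idempotent_ring T, idempotent_ring S & inhabited (morita_context T S)].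

(* Main.v *)
Require Import Defs.
From HB Require Import structures.
From mathcomp Require Import all_boot all_order all_algebra.
From mathcomp Require Import finmap all_classical.

Set Implicit Arguments.
Unset Strict Implicit.
Unset Printing Implicit Defensive.

Import GRing.Theory.
Local Open Scope ring_scope.
Local Open Scope classical_set_scope.

(** Write L for the Leavitt path algebra of E, and I_H for the ideal generated by
    the vertices in H. Everything rests on two facts about vertices and degrees.

    Vertices have no torsion: a v = 0 forces a = 0 ([scale_lvert_eq0]). This is
    seen in a representation on functions: put a copy of the natural numbers at
    each vertex and, when n > 0 edges leave the vertex, match its n residue
    classes modulo n with the copies at the ranges of these edges.

    Graded uniqueness ([graded_uniqueness]): let I and J be ideals such that a
    vertex with a nonzero multiple in J lies in I; then the homogeneous elements
    of J lie in I. Row-finiteness makes every vertex either a sink or a sum of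
    products e e^*, so a homogeneous element can be recovered from its products
    with edges on the right and with ghost edges on the left, and these products
    eventually reduce it to multiples of vertices. That homogeneous components are
    well defined is seen by letting L act on sequences of elements of L, each
    generator shifting by its degree ([homogeneous_indep]).

    For the quotient, the generators that avoid H satisfy in L/I_H the relations
    of the graph without H, and conversely sending the other generators to 0
    respects the relations of E, by saturation; this gives two inverse maps
    ([quot_removeP]). With the absence of torsion in the smaller graph it follows
    that a v is in I_H, for a <> 0, only if v is in H; hence I_H is basic and H
    can be read off from it. It is graded because vertices have degree 0.
    Conversely a graded basic ideal is generated by its vertices, by graded
    uniqueness, and these form a saturated hereditary set as they do for any
    ideal. This gives the order isomorphism, and the formulas for intersections
    and sums follow by comparing vertices.

    For a hereditary set X, let p be the formal sum of its vertices. Paths that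
    start in X stay in X, so p L p is the image of the algebra of the graph
    restricted to X, and graded uniqueness shows that this algebra embeds
    ([incl_inj]). Since I_X = L p L, the modules L p and p L with the
    multiplication of L form a Morita context ([corner_morita]). *)

(** * Rings without unit, ideals and additive spans *)

Lemma numul_sumr (A : nuRingType) (I : Type) (s : seq I) (f : I -> A) x :
  x ** (\sum_(i <- s) f i) = \sum_(i <- s) x ** f i.
Proof.
by elim: s => [|i s IH]; rewrite ?big_nil ?numulr0 // !big_cons numulDr IH.
Qed.

Section IdealClosure.
Variables (A : nuRingType) (I : ideal A).

Lemma ideal0 : ideal_set I 0. Proof. by case: (idealP I). Qed.
Lemma idealB x y : ideal_set I x -> ideal_set I y -> ideal_set I (x - y).
Proof. by case: (idealP I) => _ h _ _; apply: h. Qed.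
Lemma ideal_mull a x : ideal_set I x -> ideal_set I (a ** x).
Proof. by case: (idealP I) => _ _ h _; apply: h. Qed.
Lemma ideal_mulr a x : ideal_set I x -> ideal_set I (x ** a).
Proof. by case: (idealP I) => _ _ _ h; apply: h. Qed.

Lemma ideal_sum_seq (T : eqType) (s : seq T) (f : T -> A) :
  (forall i, i \in s -> ideal_set I (f i)) -> ideal_set I (\sum_(i <- s) f i).
Proof.
by move=> h; rewrite big_seq; apply: big_ind => //; [exact: ideal0|exact: idealD].
Qed.

End IdealClosure.

Lemma is_ideal0 (A : nuRingType) : is_ideal [set 0 : A].
Proof.
split=> // [x y -> ->|a x ->|x a ->]; first exact: subr0.
  exact: numulr0.
exact: numul0r.
Qed.

Section AdditiveSpan.
Variable A : zmodType.

Inductive addspan (P : set A) : A -> Prop :=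
| AddSpan0 : addspan P 0
| AddSpanD x y : P x -> addspan P y -> addspan P (x + y).

Lemma addspan1 (P : set A) x : P x -> addspan P x.
Proof. by move=> Px; rewrite -[x]addr0; apply: AddSpanD Px _; apply: AddSpan0. Qed.

Lemma addspan_add (P : set A) x y : addspan P x -> addspan P y -> addspan P (x + y).
Proof.
move=> hx hy; elim: hx => [|a b Pa _ IH]; first by rewrite add0r.
by rewrite -addrA; apply: AddSpanD.
Qed.

Lemma addspan_sum (P : set A) (T : eqType) (s : seq T) (h : T -> A) :
  (forall i, i \in s -> addspan P (h i)) -> addspan P (\sum_(i <- s) h i).
Proof.
by move=> hs; rewrite big_seq; apply: big_ind => //; [apply: AddSpan0|apply: addspan_add].
Qed.

End AdditiveSpan.

Lemma addspan_morph (A B : zmodType) (P : set A) (Q : set B) (h : A -> B) :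
  {morph h : x y / x + y} -> (forall x, P x -> addspan Q (h x)) ->
  forall x, addspan P x -> addspan Q (h x).
Proof.
move=> hD hP x; elim=> [|a b Pa _ IH]; last first.
  by rewrite hD; apply: addspan_add => //; apply: hP.
have -> : h 0 = 0 by apply: (addrI (h 0)); rewrite -hD !addr0.
exact: AddSpan0.
Qed.

Section HomTheory.
Variables (R : comPzRingType) (A B : nuAlgType R) (f : A -> B).
Hypothesis hf : nualg_hom f.

Lemma nualg_homZD a x y : f (a *: x + y) = a *: f x + f y.
Proof. by case: hf => h _; apply: h. Qed.
Lemma nualg_homM x y : f (x ** y) = f x ** f y.
Proof. by case: hf => _ h; apply: h. Qed.
Lemma nualg_homD x y : f (x + y) = f x + f y.
Proof. by rewrite -[x in LHS]scale1r nualg_homZD scale1r. Qed.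
Lemma nualg_hom0 : f 0 = 0.
Proof. by apply: (addrI (f 0)); rewrite -nualg_homD !addr0. Qed.
Lemma nualg_homZ a x : f (a *: x) = a *: f x.
Proof. by rewrite -[a *: x]addr0 nualg_homZD nualg_hom0 addr0. Qed.
Lemma nualg_homN x : f (- x) = - f x.
Proof. by rewrite -scaleN1r nualg_homZ scaleN1r. Qed.
Lemma nualg_homB x y : f (x - y) = f x - f y.
Proof. by rewrite nualg_homD nualg_homN. Qed.
Lemma nualg_hom_sum (I : Type) (s : seq I) (g : I -> A) :
  f (\sum_(i <- s) g i) = \sum_(i <- s) f (g i).
Proof. exact: (big_morph f nualg_homD nualg_hom0). Qed.

Lemma is_ideal_ker : is_ideal [set x | f x = 0].
Proof.
split=> [|x y|a x|x a] /=; first exact: nualg_hom0.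
- by move=> fx fy; rewrite nualg_homB fx fy subrr.
- by move=> fx; rewrite nualg_homM fx numulr0.
- by move=> fx; rewrite nualg_homM fx numul0r.
Qed.

End HomTheory.

Lemma nualg_hom_comp (R : comPzRingType) (A B C : nuAlgType R)
    (f : A -> B) (g : B -> C) :
  nualg_hom f -> nualg_hom g -> nualg_hom (g \o f).
Proof.
move=> hf hg; split=> [a x y|x y] /=.
  by rewrite (nualg_homZD hf) (nualg_homZD hg).
by rewrite (nualg_homM hf) (nualg_homM hg).
Qed.

(** * The algebra of linear endomorphisms of a module *)

Section LinearEndomorphisms.
Variables (R : comPzRingType) (V : lmodType R).

Definition lend_pred : {pred V -> V} := fun f => `[< linear f >].

Lemma lend_submod_closed : submod_closed lend_pred.
Proof.
split=> [|a f g /asboolP fl /asboolP gl]; apply/asboolP => b x y.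
  by have E z : (0 : V -> V) z = 0 by []; rewrite !E scaler0 addr0.
have E z : (a *: f + g) z = a *: f z + g z by [].
rewrite !E fl gl !scalerDr !scalerA [b * a]mulrC.
by rewrite [LHS]addrACA.
Qed.

HB.instance Definition _ :=
  GRing.isSubmodClosed.Build R (V -> V) lend_pred lend_submod_closed.

Record lend := Lend { lend_fun :> V -> V; lendP : lend_fun \in lend_pred }.

HB.instance Definition _ := [isSub for lend_fun].
HB.instance Definition _ := [Choice of lend by <:].
HB.instance Definition _ := [SubChoice_isSubLmodule of lend by <:].

Lemma lend_linear (f : lend) : linear f.
Proof. exact/asboolP/lendP. Qed.

Lemma lend_ext (f g : lend) : f =1 g -> f = g.
Proof. by move=> fg; apply/val_inj/funext. Qed.

Lemma lendDE (f g : lend) x : (f + g) x = f x + g x. Proof. by []. Qed.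
Lemma lendZE a (f : lend) x : (a *: f) x = a *: f x. Proof. by []. Qed.
Lemma lend_sumE (I : Type) (s : seq I) (f : I -> lend) x :
  (\sum_(i <- s) f i) x = \sum_(i <- s) f i x.
Proof. by elim: s => [|i s IH]; rewrite ?big_nil // !big_cons lendDE IH. Qed.

Lemma lend_mul_subproof (f g : lend) : f \o g \in lend_pred.
Proof. by apply/asboolP => a x y /=; rewrite !lend_linear. Qed.

Definition lend_mul (f g : lend) : lend := Lend (lend_mul_subproof f g).

Lemma lend_mulA : associative lend_mul.
Proof. by move=> f g h; apply: lend_ext. Qed.
Lemma lend_mulDl : left_distributive lend_mul +%R.
Proof. by move=> f g h; apply: lend_ext. Qed.
Lemma lend_mulDr : right_distributive lend_mul +%R.
Proof.
move=> f g h; apply: lend_ext => x; rewrite lendDE.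
rewrite -[LHS]/(f (g x + h x)) -[RHS]/(f (g x) + f (h x)).
by rewrite -[g x in LHS]scale1r lend_linear scale1r.
Qed.

HB.instance Definition _ := Zmodule_isNuRing.Build lend
  lend_mulA lend_mulDl lend_mulDr.

Lemma lend_scaleAl a (f g : lend) : a *: (f ** g) = (a *: f) ** g.
Proof. exact: lend_ext. Qed.
Lemma lend_scaleAr a (f g : lend) : a *: (f ** g) = f ** (a *: g).
Proof.
apply: lend_ext => x; rewrite lendZE.
have f0 : f 0 = 0.
  have := lend_linear f 1 0 0; rewrite !scale1r addr0 => h.
  by apply: (addrI (f 0)); rewrite addr0 -h.
rewrite -[LHS]/(a *: f (g x)) -[RHS]/(f (a *: g x)).
by rewrite -[a *: g x in RHS]addr0 lend_linear f0 addr0.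
Qed.

HB.instance Definition _ := NuRing_Lmodule_isNuAlg.Build R lend
  lend_scaleAl lend_scaleAr.

Lemma lendME (f g : lend) x : (f ** g) x = f (g x). Proof. by []. Qed.

End LinearEndomorphisms.

(** * Paths and homogeneous elements *)

Section Generators.
Variables (R : comPzRingType) (E : graph).
Local Notation L := (leavitt R E).

Lemma lvertM v w : lvert R v ** lvert R w = if v == w then lvert R v else 0 :> L.
Proof. by have [h _ _ _ _] := leavitt_gen_family R E; apply: h. Qed.
Lemma lvertMid v : lvert R v ** lvert R v = lvert R v :> L.
Proof. by rewrite lvertM eqxx. Qed.
Lemma lvert_edge e : lvert R (src e) ** ledge R e = ledge R e :> L.
Proof. by have [_ /(_ e)[]] := leavitt_gen_family R E. Qed.
Lemma ledge_vert e : ledge R e ** lvert R (rng e) = ledge R e :> L.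
Proof. by have [_ /(_ e)[]] := leavitt_gen_family R E. Qed.
Lemma lvert_ghost e : lvert R (rng e) ** lghost R e = lghost R e :> L.
Proof. by have [_ _ /(_ e)[]] := leavitt_gen_family R E. Qed.
Lemma lghost_vert e : lghost R e ** lvert R (src e) = lghost R e :> L.
Proof. by have [_ _ /(_ e)[]] := leavitt_gen_family R E. Qed.
Lemma lghost_edge e f :
  lghost R e ** ledge R f = if e == f then lvert R (rng e) else 0 :> L.
Proof. by have [_ _ _ h _] := leavitt_gen_family R E; apply: h. Qed.
Lemma lvert_reg v : regular v ->
  lvert R v = \sum_(e <- fset_set (out_edges v)) ledge R e ** lghost R e :> L.
Proof.
move=> vreg; have [_ _ _ _ ->//] := leavitt_gen_family R E.
by rewrite fsbig_finite //; case: vreg.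
Qed.

Lemma leavitt_right_unit (x : L) : exists s : seq (vert E),
  forall s', uniq s' -> {subset s <= s'} -> x ** (\sum_(v <- s') lvert R v) = x.
Proof.
have base v (y : L) : y ** lvert R v = y -> exists s : seq (vert E),
    forall s', uniq s' -> {subset s <= s'} -> y ** (\sum_(w <- s') lvert R w) = y.
  move=> vy; exists [:: v] => s' us' ss'.
  rewrite numul_sumr (bigD1_seq v) //=; last by apply: ss'; rewrite inE.
  rewrite vy big1 ?addr0 // => w wv.
  by rewrite -vy -numulA lvertM eq_sym (negPf wv) numulr0.
elim/leavitt_ind: x => [v|e|e||x [s h]|x y [s h] [t k]|a x [s h]|x y _ [s h]].
- exact/(base v)/lvertMid.
- exact/(base (rng e))/ledge_vert.
- exact/(base (src e))/lghost_vert.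
- by exists [::] => s' _ _; rewrite numul0r.
- by exists s => s' us ss; rewrite numulNr h.
- exists (s ++ t) => s' us ss; rewrite numulDl h ?k // => z zs; apply: ss.
    by rewrite mem_cat zs orbT.
  by rewrite mem_cat zs.
- by exists s => s' us ss; rewrite -nuscaleAl h.
- by exists s => s' us ss; rewrite -numulA h.
Qed.

Lemma leavitt_sum_left (x : L) : exists s : seq (vert E),
  x = \sum_(v <- s) lvert R v ** x.
Proof.
have [s h] := leavitt_left_unit x; exists (undup s).
rewrite -numul_suml h ?undup_uniq // => v.
by rewrite mem_undup.
Qed.

Lemma leavitt_sum_right (x : L) : exists s : seq (vert E),
  x = \sum_(v <- s) x ** lvert R v.
Proof.
have [s h] := leavitt_right_unit x; exists (undup s).
rewrite -numul_sumr h ?undup_uniq // => v.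
by rewrite mem_undup.
Qed.

(** The vertex [v] gives the value on the empty list, where no edge records the
    source. Recursion on the head is what the inductions below need: the first
    edge of a path is the one that meets a factor on its left. *)
Fixpoint walk_elt (v : vert E) (s : seq (edge E)) : L :=
  if s is e :: s' then ledge R e ** walk_elt (rng e) s' else lvert R v.
Fixpoint walk_star (v : vert E) (s : seq (edge E)) : L :=
  if s is e :: s' then walk_star (rng e) s' ** lghost R e else lvert R v.

Definition walk_end (v : vert E) (s : seq (edge E)) := last v (map (@rng E) s).

Lemma path_eltE (p : gpath E) : path_elt R p = walk_elt (gpath_src p) (gpath_edges p).
Proof.
case: p => v [|e s] w; rewrite /path_elt //= {w}.
elim: s {v e} (ledge R e) (rng e) (ledge_vert e) => [|f s IH] x w xw //=.
by rewrite (IH _ (rng f)) -?numulA ?ledge_vert.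
Qed.

Lemma path_starE (p : gpath E) : path_star R p = walk_star (gpath_src p) (gpath_edges p).
Proof.
case: p => v [|e s] w; rewrite /path_star //= {w}.
elim: s {v e} (lghost R e) (rng e) (lvert_ghost e) => [|f s IH] x w xw //=.
by rewrite (IH _ (rng f)) ?numulA ?lvert_ghost.
Qed.

Lemma lvert_walk_elt u v s : walk v s ->
  lvert R u ** walk_elt v s = if u == v then walk_elt v s else 0.
Proof.
case: s => [_|e s /= /andP[/eqP sv _]]; first by rewrite /= lvertM; case: eqVneq => [->|].
by rewrite -lvert_edge !numulA lvertM sv; case: eqVneq => [->//|]; rewrite !numul0r.
Qed.

Lemma ledge_walk_elt e v s : walk v s ->
  ledge R e ** walk_elt v s = if rng e == v then walk_elt (src e) (e :: s) else 0.
Proof.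
move=> w; rewrite -ledge_vert -numulA lvert_walk_elt //.
by case: eqVneq => [<-//|]; rewrite ?numulA ?ledge_vert ?numulr0.
Qed.

Lemma lghost_walk_elt e f v s : walk v (f :: s) ->
  lghost R e ** walk_elt v (f :: s) = if e == f then walk_elt (rng e) s else 0.
Proof.
move=> /= /andP[_ w]; rewrite numulA lghost_edge.
by case: eqVneq => [->|]; rewrite ?lvert_walk_elt ?eqxx // numul0r.
Qed.

Lemma walk_end_walk_star v s : lvert R (walk_end v s) ** walk_star v s = walk_star v s.
Proof.
elim: s v => [v|e s IH v]; first exact: lvertMid.
by rewrite /= numulA IH.
Qed.

Lemma walk_star_vert v s : walk v s -> walk_star v s ** lvert R v = walk_star v s.
Proof.
case: s => [|e s /= /andP[/eqP <- _]]; first by rewrite /= lvertMid.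
by rewrite -numulA lghost_vert.
Qed.

Lemma walk_star_vertM v w s : walk v s ->
  walk_star v s ** lvert R w = if v == w then walk_star v s else 0 :> L.
Proof.
move=> vs; rewrite -(walk_star_vert vs) -numulA lvertM; case: eqP => // _.
by rewrite numulr0.
Qed.

Lemma lghost_walk_star e v s : walk v s ->
  lghost R e ** walk_star v s =
    if src e == walk_end v s then walk_star v (rcons s e) else 0.
Proof.
rewrite -walk_end_walk_star -lghost_vert -numulA (numulA (lvert _ _)) lvertM.
case: eqVneq => [se w|]; last by rewrite numul0r numulr0.
rewrite se walk_end_walk_star; elim: s v w se => [|f s IH] v /=.
  by move=> _ sev; rewrite -[v]sev lghost_vert lvert_ghost.
by move=> /andP[_ w] se; rewrite numulA IH.
Qed.

Lemma walk_rcons v s e :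
  walk v (rcons s e) = walk v s && (src e == walk_end v s).
Proof.
elim: s v => [|f s IH] v /=; first by rewrite andbT.
by rewrite IH andbA.
Qed.

Lemma leavitt_deg0 k : leavitt_deg k (0 : L).
Proof.
have p : 'I_0 -> gpath E by case.
by exists 0%N, (fun _ => 0), p, p; split; [case|rewrite big_ord0].
Qed.

Lemma leavitt_degD k (x y : L) :
  leavitt_deg k x -> leavitt_deg k y -> leavitt_deg k (x + y).
Proof.
move=> [N [a [p [q [pq ->]]]]] [M [b [p' [q' [pq' ->]]]]].
pose glue T (f : 'I_N -> T) (g : 'I_M -> T) (i : 'I_(N + M)) :=
  match fintype.split i with inl j => f j | inr j => g j end.
exists (N + M)%N, (glue _ a b), (glue _ p p'), (glue _ q q'); split.
  by move=> i; rewrite /glue; case: (fintype.split i).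
have gl T f g i : @glue T f g (lshift M i) = f i.
  by rewrite /glue -[lshift M i]/(unsplit (inl i)) unsplitK.
have gr T f g i : @glue T f g (rshift N i) = g i.
  by rewrite /glue -[rshift N i]/(unsplit (inr i)) unsplitK.
by rewrite big_split_ord; congr (_ + _); apply: eq_bigr => i _; rewrite ?gl ?gr.
Qed.

Lemma leavitt_deg_mono k a v s w t : walk v s -> walk w t ->
  (size s)%:Z - (size t)%:Z = k -> leavitt_deg k (a *: (walk_elt v s ** walk_star w t)).
Proof.
move=> vs wt st; exists 1%N, (fun=> a), (fun=> GPath vs), (fun=> GPath wt).
by split=> //; rewrite big_ord1 path_eltE path_starE.
Qed.

Lemma leavitt_deg_ind k (P : L -> Prop) : P 0 ->
  (forall x y, P x -> P y -> P (x + y)) ->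
  (forall a v s w t, walk v s -> walk w t -> (size s)%:Z - (size t)%:Z = k ->
     P (a *: (walk_elt v s ** walk_star w t))) ->
  forall x, leavitt_deg k x -> P x.
Proof.
move=> P0 PD Pm x [N [a [p [q [pq ->]]]]]; apply: big_ind => // i _.
rewrite path_eltE path_starE; have := pq i.
by case: (p i) (q i) => v s vs [w t wt]; apply: Pm.
Qed.

Lemma leavitt_degZ k a (x : L) : leavitt_deg k x -> leavitt_deg k (a *: x).
Proof.
elim/leavitt_deg_ind => [|{}x y hx hy|b v s w t vs wt st].
- by rewrite scaler0; apply: leavitt_deg0.
- by rewrite scalerDr; apply: leavitt_degD.
- by rewrite scalerA; apply: leavitt_deg_mono.
Qed.

Lemma leavitt_deg_sub k (g : L -> L) l : {morph g : x y / x + y} ->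
  (forall a x, g (a *: x) = a *: g x) ->
  (forall v s w t, walk v s -> walk w t -> (size s)%:Z - (size t)%:Z = k ->
     leavitt_deg l (g (walk_elt v s ** walk_star w t))) ->
  forall x, leavitt_deg k x -> leavitt_deg l (g x).
Proof.
move=> gD gZ gm x; elim/leavitt_deg_ind => [|{}x y hx hy|b v s w t vs wt st].
- by rewrite -(scale0r 0) gZ scale0r; apply: leavitt_deg0.
- by rewrite gD; apply: leavitt_degD.
- by rewrite gZ; apply/leavitt_degZ/gm.
Qed.

Lemma leavitt_deg_vertl k v (x : L) :
  leavitt_deg k x -> leavitt_deg k (lvert R v ** x).
Proof.
move: x; apply: leavitt_deg_sub => // [x y|a x|u s w t us wt st].
- exact: numulDr.
- by rewrite nuscaleAr.
rewrite numulA lvert_walk_elt //.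
case: eqP => _; last by rewrite numul0r; apply: leavitt_deg0.
by rewrite -[_ ** _]scale1r; apply: leavitt_deg_mono.
Qed.

Lemma leavitt_deg_edgel k e (x : L) :
  leavitt_deg k x -> leavitt_deg (1 + k) (ledge R e ** x).
Proof.
move: x; apply: leavitt_deg_sub => // [x y|a x|u s w t us wt st].
- exact: numulDr.
- by rewrite nuscaleAr.
rewrite numulA ledge_walk_elt //.
case: eqP => [eu|]; last by rewrite numul0r => _; apply: leavitt_deg0.
rewrite -[_ ** _]scale1r; apply: leavitt_deg_mono => //=.
  by rewrite eqxx eu.
by rewrite -st intS addrA.
Qed.

Lemma leavitt_deg_ghostl k e (x : L) :
  leavitt_deg k x -> leavitt_deg (- 1 + k) (lghost R e ** x).
Proof.
move: x; apply: leavitt_deg_sub => // [x y|a x|u s w t us wt <-].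
- exact: numulDr.
- by rewrite nuscaleAr.
case: s us => [|f s] us.
  rewrite /= -lghost_vert -numulA (numulA (lvert _ _)) lvertM.
  case: eqP => _; last by rewrite numul0r numulr0; apply: leavitt_deg0.
  rewrite numulA lghost_vert lghost_walk_star //.
  case: eqP => [ewt|_]; last exact: leavitt_deg0.
  rewrite -walk_end_walk_star -[_ ** _]scale1r.
  apply: (@leavitt_deg_mono _ _ _ [::]) => //; first by rewrite walk_rcons wt ewt eqxx.
  by rewrite size_rcons intS opprD !add0r.
rewrite numulA lghost_walk_elt //.
case: eqP => [ef|_]; last by rewrite numul0r; apply: leavitt_deg0.
rewrite -[_ ** _]scale1r; apply: leavitt_deg_mono => //.
  by case/andP: us => _; rewrite ef.
by rewrite /= intS -addrA addKr.
Qed.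

(** A monomial multiplies on the left as a succession of generators, each of
    which sends monomials to monomials or to 0 and shifts the degree by its own. *)
Lemma leavitt_degM j k (x y : L) :
  leavitt_deg j x -> leavitt_deg k y -> leavitt_deg (j + k) (x ** y).
Proof.
move=> hx hy; move: x hx.
apply: (@leavitt_deg_ind j (fun x => leavitt_deg (j + k) (x ** y))).
- by rewrite numul0r; apply: leavitt_deg0.
- by move=> x z hx hz; rewrite numulDl; apply: leavitt_degD.
move=> a v s w t _ _ <- {j}; rewrite -nuscaleAl -numulA -addrA; apply: leavitt_degZ.
have {hy}: leavitt_deg (- (size t)%:Z + k) (walk_star w t ** y).
  elim: t w k y hy => [|e t IH] w k y hy /=.
    by rewrite oppr0 add0r; apply: leavitt_deg_vertl.
  rewrite -numulA intS opprD addrAC addrC.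
  exact/IH/leavitt_deg_ghostl.
elim: s v => [|e s IH] v hy /=.
  by rewrite add0r; apply: leavitt_deg_vertl.
by rewrite -numulA intS -addrA; apply/leavitt_deg_edgel/IH.
Qed.

Lemma leavitt_deg_vert v : leavitt_deg 0 (lvert R v : L).
Proof.
rewrite -lvertMid -[_ ** _]scale1r.
exact: (@leavitt_deg_mono 0 1 v [::] v [::]).
Qed.

Lemma leavitt_deg_edge e : leavitt_deg 1 (ledge R e : L).
Proof.
by rewrite -ledge_vert -[X in leavitt_deg X]addr0;
  apply/leavitt_deg_edgel/leavitt_deg_vert.
Qed.

Lemma leavitt_deg_ghost e : leavitt_deg (-1) (lghost R e : L).
Proof.
by rewrite -lghost_vert -[X in leavitt_deg X]addr0;
  apply/leavitt_deg_ghostl/leavitt_deg_vert.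
Qed.

End Generators.

(** * Uniqueness of homogeneous components *)

Section ShiftRepresentation.
Variables (R : comPzRingType) (E : graph).
Local Notation L := (leavitt R E).

Lemma shift_op_subproof (a : L) (d : int) :
  (fun (m : int -> L) j => a ** m (j - d)) \in @lend_pred R (int -> L).
Proof.
apply/asboolP => b m n; apply/funext => j.
by rewrite -[LHS]/(a ** (b *: m (j - d) + n (j - d))) numulDr -nuscaleAr.
Qed.

Definition shift_op (a : L) (d : int) : lend (int -> L) :=
  Lend (shift_op_subproof a d).

Lemma shift_opM a b c d : shift_op a c ** shift_op b d = shift_op (a ** b) (c + d).
Proof.
apply: lend_ext => m; apply/funext => j.
by rewrite -[LHS]/(a ** (b ** m (j - c - d))) numulA /= opprD addrA.
Qed.

Lemma shift_op0 d : shift_op 0 d = 0.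
Proof. by apply: lend_ext => m; apply/funext => j; apply: numul0r. Qed.

Lemma shift_opD a b d : shift_op (a + b) d = shift_op a d + shift_op b d.
Proof. by apply: lend_ext => m; apply/funext => j; apply: numulDl. Qed.

Lemma shift_opZ r a d : shift_op (r *: a) d = r *: shift_op a d.
Proof.
apply: lend_ext => m; apply/funext => j; rewrite lendZE.
by rewrite -[RHS]/(r *: (a ** m (j - d))) nuscaleAl.
Qed.

Lemma shift_family_subproof : is_leavitt_family
  (fun v => shift_op (lvert R v) 0) (fun e => shift_op (ledge R e) 1)
  (fun e => shift_op (lghost R e) (-1)).
Proof.
split=> [v w|e|e|e f|v vreg]; rewrite ?shift_opM.
- by rewrite lvertM addr0; case: eqP => // _; rewrite shift_op0.
- by rewrite lvert_edge ledge_vert addr0 add0r.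
- by rewrite lvert_ghost lghost_vert addr0 add0r.
- by rewrite lghost_edge addNr; case: eqP => // _; rewrite shift_op0.
- rewrite fsbig_finite; last by case: vreg.
  under eq_bigr do rewrite shift_opM subrr.
  rewrite /= lvert_reg //; apply: (big_morph (shift_op^~ 0)).
    by move=> a b; apply: shift_opD.
  exact: shift_op0.
Qed.

(** Laurent polynomials over L act on sequences by multiplication and shifts;
    the exponent of the variable records the degree of a generator. *)
Definition shift_family := LeavittFamily shift_family_subproof.
Definition shift_rep := leavitt_lift shift_family.

Lemma shift_rep_hom : nualg_hom shift_rep.
Proof. exact: leavitt_lift_hom. Qed.

Lemma shift_repE k (x : L) : leavitt_deg k x -> shift_rep x = shift_op x k.
Proof.
have hom := shift_rep_hom.
elim/leavitt_deg_ind => [|{}x y hx hy|b v s w t vs wt <-].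
- by rewrite (nualg_hom0 hom) shift_op0.
- by rewrite (nualg_homD hom) hx hy shift_opD.
rewrite (nualg_homZ hom) (nualg_homM hom) shift_opZ -shift_opM; congr (_ *: (_ ** _)).
  elim: s v {vs} => [|e s IH] v /=; first exact: leavitt_lift_vert.
  by rewrite (nualg_homM hom) IH /shift_rep leavitt_lift_edge /= shift_opM intS.
elim: t w {wt} => [|e t IH] w /=; first exact: leavitt_lift_vert.
rewrite (nualg_homM hom) IH /shift_rep leavitt_lift_ghost /= shift_opM.
by rewrite intS opprD addrC.
Qed.

(** A homogeneous element of degree k moves the entry at 0 of a sequence to the
    place k, so elements of distinct degrees act into distinct places. *)
Lemma homogeneous_indep (s : seq int) (f : int -> L) : uniq s ->
  (forall k, leavitt_deg k (f k)) -> \sum_(k <- s) f k = 0 ->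
  forall k, k \in s -> f k = 0.
Proof.
move=> us fdeg f0 j js; have [u uE] := leavitt_right_unit (f j).
(* A right unit of [f j] at the place 0: its image has [f j] at the place j. *)
pose one := \sum_(v <- undup u) lvert R v.
pose m : int -> L := fun i => if i == 0 then one else 0.
have /(congr1 (fun g : lend (int -> L) => g m j)) := congr1 shift_rep f0.
rewrite (nualg_hom0 shift_rep_hom) (nualg_hom_sum shift_rep_hom) lend_sumE.
rewrite (big_morph (fun g : int -> L => g j) (id1 := 0) (op1 := +%R)) //.
rewrite (bigD1_seq j) //= (shift_repE (fdeg j)) /= subrr big1 => [|i ij]; last first.
  rewrite (shift_repE (fdeg i)) /= /m subr_eq0.
  by rewrite eq_sym (negPf ij) numulr0.
rewrite addr0 /m eqxx uE ?undup_uniq // => v.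
by rewrite mem_undup.
Qed.

End ShiftRepresentation.

Section Graded.
Variables (R : comPzRingType) (E : graph).
Local Notation L := (leavitt R E).
Implicit Types (I J : set L) (x y : L).

Definition homog_gen I : L -> Prop :=
  addspan [set x | I x /\ exists k, leavitt_deg k x].

Lemma homog_gen1 I k x : I x -> leavitt_deg k x -> homog_gen I x.
Proof. by move=> Ix xk; apply: addspan1; split=> //; exists k. Qed.

Lemma homog_gen_morph I J (g : L -> L) : {morph g : x y / x + y} ->
  (forall k x, I x -> leavitt_deg k x -> homog_gen J (g x)) ->
  forall x, homog_gen I x -> homog_gen J (g x).
Proof. by move=> gD gh; apply: addspan_morph => // x [Ix [k]]; apply: gh. Qed.

Lemma homog_genM I J K x y : (forall a b, I a -> J b -> K (a ** b)) ->
  homog_gen I x -> homog_gen J y -> homog_gen K (x ** y).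
Proof.
move=> IJK hx hy; move: x hx; apply: homog_gen_morph => [a b|k a Ia ak].
  exact: numulDl.
move: y hy; apply: homog_gen_morph => [b c|l b Jb bl]; first exact: numulDr.
by apply: homog_gen1 (leavitt_degM ak bl); apply: IJK.
Qed.

Lemma homog_genZ I a x : (forall y, I y -> I (a *: y)) ->
  homog_gen I x -> homog_gen I (a *: x).
Proof.
move=> Ia; move: x; apply: homog_gen_morph => [x y|k x Ix xk].
  exact: scalerDr.
by apply: homog_gen1 (leavitt_degZ _ xk); apply: Ia.
Qed.

Lemma homog_genT x : homog_gen setT x.
Proof.
elim/leavitt_ind: x => [v|e|e||x hx|x y hx hy|a x hx|x y hx hy].
- exact: homog_gen1 (leavitt_deg_vert R v).
- exact: homog_gen1 (leavitt_deg_edge R e).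
- exact: homog_gen1 (leavitt_deg_ghost R e).
- exact: AddSpan0.
- by rewrite -scaleN1r; apply: homog_genZ.
- exact: addspan_add.
- exact: homog_genZ.
- exact: homog_genM hx hy.
Qed.

(** Collects the terms of equal degree, which gives the form of a decomposition
    that the definition of a graded ideal asks for. *)
Lemma homog_gen_components I x : I 0 -> (forall x y, I x -> I y -> I (x + y)) ->
  homog_gen I x -> exists (s : seq int) (f : int -> L),
    [/\ uniq s, forall k, I (f k) /\ leavitt_deg k (f k),
        forall k, k \notin s -> f k = 0 & x = \sum_(k <- s) f k].
Proof.
move=> I0 ID; elim=> {x} [|x y [Ix [k xk]] _ [s [f [us fI fs ->]]]].
  exists [::], (fun=> 0); split=> // [k|]; last by rewrite big_nil.
  by split=> //; apply: leavitt_deg0.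
exists (undup (k :: s)), (fun j => (if j == k then x else 0) + f j).
split=> [|j|j|].
- exact: undup_uniq.
- case: (fI j) => Ifj fj; split.
    by case: eqP => _; rewrite ?add0r //; apply: ID.
  by case: eqP => [->|_]; rewrite ?add0r //; apply: leavitt_degD => //; case: (fI k).
- rewrite mem_undup inE negb_or => /andP[/negPf-> /fs->].
  exact: addr0.
rewrite big_split; congr (_ + _).
  rewrite (bigD1_seq k) ?undup_uniq ?mem_undup ?mem_head // big1 /= ?eqxx ?addr0 //.
  by move=> j /negPf->.
rewrite /=; case: ifP => [_|/negbT ks]; first by rewrite undup_id.
by rewrite big_cons (fs k) // add0r undup_id.
Qed.

(** Uniqueness of the decomposition is the independence of homogeneous elements
    of distinct degrees, so only existence depends on the ideal. *)
Lemma gradedP I : is_ideal I -> graded I <-> (forall x, I x -> homog_gen I x).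
Proof.
move=> hI; split=> [[_ gI] x /gI[f [[fI ff ->] _]]|hgI].
  rewrite (@fsbigTE _ _ _ _ (fset_set [set k | f k != 0])); last first.
    move=> k; rewrite in_fset_set // => /negP kf.
    by apply: contra_notP kf => /eqP fk; apply/mem_set.
  elim: (enum_fset _) => [|k s IH]; first by rewrite big_nil; apply: AddSpan0.
  by rewrite big_cons; case: (fI k) => Ik fk; apply: AddSpanD IH; split=> //; exists k.
split=> [k x [] //|x Ix].
have [s [f [us fI fs xE]]] := homog_gen_components (ideal0 (Ideal hI))
  (idealD (I := Ideal hI)) (hgI x Ix).
have sumE (g : int -> L) (t : seq int) : uniq t -> (forall k, k \notin t -> g k = 0) ->
    \sum_(k \in setT) g k = \sum_(k <- t) g k.
  move=> ut gt; rewrite (@fsbigE _ _ _ _ _ t _ ut) //; last by move=> k _; apply: gt.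
  by apply: eq_bigl => k; rewrite in_setT.
exists f; split.
  split=> //; last by rewrite (sumE f s).
  apply: (@sub_finite_set _ _ [set` s]); last exact: finite_seq.
  by move=> k; apply: contra_neqT => /fs.
move=> g [gI gfin xE']; apply/funext => k; apply/eqP; rewrite -subr_eq0; apply/eqP.
pose t := undup (k :: s ++ fset_set [set k | g k != 0]).
have tu : uniq t by apply: undup_uniq.
have ts j : j \notin t -> f j = 0 /\ g j = 0.
  rewrite mem_undup inE mem_cat !negb_or => /and3P[_ /fs-> jg]; split=> //.
  move: jg; rewrite in_fset_set // => /negP jg.
  by apply: contra_notP jg => /eqP gj; apply/mem_set.
apply: (@homogeneous_indep R E t (fun j => f j - g j)) => //.
- move=> j; rewrite -scaleN1r; apply: leavitt_degD; first by case: (fI j).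
  by apply: leavitt_degZ; case: (gI j).
- rewrite sumrB -(sumE f t) // => [|j /ts[]//].
  rewrite -(sumE g t) // => [|j /ts[]//].
  by rewrite -xE' xE -(sumE f s) // subrr.
by rewrite mem_undup mem_head.
Qed.

(** The components of x in I and those in J are both its components in L, so
    they are the same elements. *)
Lemma gradedI I J : is_ideal I -> is_ideal J -> graded I -> graded J ->
  forall x, I x -> J x -> homog_gen (I `&` J) x.
Proof.
move=> hI hJ /(gradedP hI) gI /(gradedP hJ) gJ x Ix Jx.
have [s [f [us fI fs xE]]] := homog_gen_components (ideal0 (Ideal hI))
  (idealD (I := Ideal hI)) (gI x Ix).
have [t [g [ut gJJ gt xE']]] := homog_gen_components (ideal0 (Ideal hJ))
  (idealD (I := Ideal hJ)) (gJ x Jx).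
have fg : f = g.
  have hT : is_ideal (setT : set L) by [].
  have [_ /(_ x Logic.I)[h [_ hu]]] := (gradedP hT).2 (fun x _ => homog_genT x).
  have hE (k : seq int) (p : int -> L) : uniq k -> (forall j, leavitt_deg j (p j)) ->
     (forall j, j \notin k -> p j = 0) -> x = \sum_(j <- k) p j -> h = p.
    move=> uk pd pk pE; apply: hu; split=> [j|| ].
    - by split.
    - apply: (@sub_finite_set _ _ [set` k]); last exact: finite_seq.
      by move=> j; apply: contra_neqT => /pk.
    - rewrite (@fsbigE _ _ _ _ _ k _ uk) //; last by move=> j _; apply: pk.
      by rewrite pE; apply: eq_bigl => j; rewrite in_setT.
  by rewrite -(hE s f) // => [|j]; [apply: (hE t g) => // j; case: (gJJ j)|case: (fI j)].
rewrite xE; elim: (s) => [|k l IH]; first by rewrite big_nil; apply: AddSpan0.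
rewrite big_cons; case: (fI k) (gJJ k) => Ik fk [Jk _].
by apply: AddSpanD IH; split; [split=> //; rewrite fg|exists k].
Qed.

Lemma is_idealI I J : is_ideal I -> is_ideal J -> is_ideal (I `&` J).
Proof.
move=> [I0 IB Il Ir] [J0 JB Jl Jr].
by split=> // [x y [? ?] [? ?]|a x [? ?]|x a [? ?]]; split; auto.
Qed.

(** Vertices have degree 0, so the sums of homogeneous elements of the ideal
    form an ideal that contains its generators. *)
Lemma vert_ideal_graded (X : set (vert E)) : graded (vert_ideal R X).
Proof.
apply/gradedP => [|x Ix]; first exact: idealP.
set I := vert_ideal R X in Ix *.
suff [] : (ideal_set I `&` homog_gen I) x by [].
apply: Ix; split=> [|_ [v Xv <-]]; last first.
  have Iv : ideal_set I (lvert R v) by move=> J [_]; apply; exists v.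
  by split=> //; apply: homog_gen1 Iv (leavitt_deg_vert R v).
split=> [|{}x y [Ix hx] [Iy hy]|a {}x [Ix hx]|{}x a [Ix hx]]; split.
- exact: ideal0.
- exact: AddSpan0.
- exact: idealB.
- apply: addspan_add => //; rewrite -scaleN1r.
  by apply: homog_genZ => // z; apply: leavitt_idealZ.
- exact: ideal_mull.
- by apply: homog_genM (homog_genT a) hx => b c _; apply: ideal_mull.
- exact: ideal_mulr.
- by apply: homog_genM hx (homog_genT a) => b c Ib _; apply: ideal_mulr.
Qed.

End Graded.

(** * A representation in which vertices have no torsion *)

Section PartialMapOperators.
Variables (R : comPzRingType) (X : Type).

Lemma pmap_op_subproof (f : X -> option X) :
  (fun (m : X -> R^o) x => if f x is Some y then m y else 0)
    \in @lend_pred R (X -> R^o).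
Proof.
apply/asboolP => a m n; apply/funext => x; have E (p q : X -> R^o) z :
  (a *: p + q) z = a *: p z + q z by [].
by rewrite E; case: (f x) => [y|]; rewrite ?E // scaler0 addr0.
Qed.

Definition pmap_op (f : X -> option X) : lend (X -> R^o) :=
  Lend (pmap_op_subproof f).

Lemma pmap_opE f m x : pmap_op f m x = if f x is Some y then m y else 0.
Proof. by []. Qed.

(** Composition of these operators reverses that of the partial maps, so the
    relations of a Leavitt family become identities between partial maps. *)
Lemma pmap_opM f g : pmap_op f ** pmap_op g = pmap_op (obind g \o f).
Proof.
by apply: lend_ext => m; apply/funext => x; rewrite lendME !pmap_opE /=; case: (f x).
Qed.

Lemma eq_pmap_op f g : f =1 g -> pmap_op f = pmap_op g.
Proof. by move=> fg; congr pmap_op; apply/funext. Qed.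

Lemma pmap_op0 f : f =1 (fun=> None) -> pmap_op f = 0.
Proof. by move=> /eq_pmap_op->; apply: lend_ext => m. Qed.

End PartialMapOperators.

Section BranchingRepresentation.
Variables (R : comPzRingType) (E : graph) (rfE : row_finite E).

Definition outs (v : vert E) : seq (edge E) := fset_set (out_edges v).

Lemma mem_outs e v : (e \in outs v) = (src e == v).
Proof.
rewrite in_fset_set; last exact: rfE.
by apply/idP/eqP => [/set_mem|?]; last exact/mem_set.
Qed.

Lemma outs_uniq v : uniq (outs v). Proof. exact: fset_uniq. Qed.

Lemma index_outs e : (index e (outs (src e)) < size (outs (src e)))%N.
Proof. by rewrite index_mem mem_outs. Qed.

Local Notation X := (vert E * nat)%type.

Definition branch_vert (v : vert E) (p : X) : option X :=
  if p.1 == v then Some p else None.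
Definition branch_edge (e : edge E) (p : X) : option X :=
  if (p.1 == src e) && (p.2 %% size (outs (src e)) == index e (outs (src e)))%N
  then Some (rng e, (p.2 %/ size (outs (src e)))%N) else None.
Definition branch_ghost (e : edge E) (p : X) : option X :=
  if p.1 == rng e
  then Some (src e, (p.2 * size (outs (src e)) + index e (outs (src e)))%N)
  else None.

Lemma branch_family_subproof : is_leavitt_family
  (fun v => pmap_op R (branch_vert v)) (fun e => pmap_op R (branch_edge e))
  (fun e => pmap_op R (branch_ghost e)).
Proof.
split=> [v w|e|e|e f|v vreg]; rewrite ?pmap_opM.
- case: eqP => [->|vw]; [apply: eq_pmap_op|apply: pmap_op0] => -[u k] /=.
    by rewrite /branch_vert /=; case: eqP => //= ->; rewrite eqxx.
  by rewrite /branch_vert /=; case: eqP => //= ->; case: eqP.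
- split; apply: eq_pmap_op => -[u k] /=.
    by rewrite /branch_vert /branch_edge /=; case: eqP => //= ->; rewrite eqxx.
  by rewrite /branch_vert /branch_edge /=; case: ifP => //= _; rewrite eqxx.
- split; apply: eq_pmap_op => -[u k] /=.
    by rewrite /branch_vert /branch_ghost /=; case: eqP => //= ->; rewrite eqxx.
  by rewrite /branch_vert /branch_ghost /=; case: ifP => //= _; rewrite eqxx.
- have dE := index_outs e.
  have d0 : (0 < size (outs (src e)))%N by apply: leq_ltn_trans dE.
  case: eqP => [<-|ef]; [apply: eq_pmap_op|apply: pmap_op0] => -[u k] /=.
    rewrite /branch_vert /branch_ghost /branch_edge /=; case: eqP => //= ->.
    by rewrite eqxx modnMDl modn_small // eqxx divnMDl // divn_small // addn0.
  rewrite /branch_ghost /branch_edge /=; case: eqP => //= _.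
  case: ifP => // /andP[/eqP sef]; rewrite -sef modnMDl modn_small // => /eqP ief.
  case: ef; rewrite -(nth_index e (s := outs (src e)) (x := e)) ?mem_outs // ief.
  by rewrite nth_index // mem_outs sef.
apply: lend_ext => m; apply/funext => -[u k].
rewrite fsbig_finite; last by case: vreg.
rewrite lend_sumE (big_morph (fun g : X -> R^o => g (u, k)) (id1 := 0) (op1 := +%R)) //.
rewrite pmap_opE /branch_vert /=.
have term e : e \in outs v ->
    (pmap_op R (branch_edge e) ** pmap_op R (branch_ghost e)) m (u, k)
    = if (u == v) && (k %% size (outs v) == index e (outs v))%N then m (u, k) else 0.
  rewrite mem_outs pmap_opM pmap_opE /= /branch_edge /branch_ghost /= => /eqP ->.
  case: ifP => //= /andP[/eqP -> /eqP <-]; rewrite eqxx.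
  by rewrite -divn_eq.
rewrite big_seq (eq_bigr _ term) -big_seq.
case: eqP => [uv|_] /=; last by rewrite big1.
have n0 : (0 < size (outs v))%N.
  by case: vreg => -[e <-] _; apply: leq_ltn_trans (index_outs e).
have kn : (k %% size (outs v) < size (outs v))%N by rewrite ltn_mod.
have [e0 _] : out_edges v !=set0 by case: vreg.
(* Only the edge whose index is the residue of k contributes. *)
rewrite (bigD1_seq (nth e0 (outs v) (k %% size (outs v)))) ?mem_nth ?outs_uniq //=.
rewrite index_uniq ?outs_uniq // eqxx big_seq_cond big1 ?addr0 //= => e /andP[ev ek].
case: ifP => // /eqP kE; case/eqP: ek.
by rewrite kE nth_index.
Qed.

(** Each vertex carries a copy of the natural numbers; the copy at a vertex with
    n > 0 outgoing edges is cut into the n residue classes modulo n, each of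
    them matched with the copy at the range of one of these edges. *)
Definition branch_family := LeavittFamily branch_family_subproof.

(** The vertex v acts as the restriction of functions to its copy of the natural
    numbers, so the constant function 1 detects the coefficient. *)
Lemma scale_lvert_eq0 a v : a *: lvert R v = 0 :> leavitt R E -> a = 0.
Proof.
move=> av0; have hom := leavitt_lift_hom branch_family.
have /(congr1 (fun g : lend (X -> R^o) => g (fun=> 1) (v, 0%N))) :=
  congr1 (leavitt_lift branch_family) av0.
rewrite (nualg_homZ hom) (nualg_hom0 hom) leavitt_lift_vert lendZE /=.
have scaleE (p : X -> R^o) z : (a *: p) z = a * p z by [].
by rewrite scaleE /= /branch_vert eqxx mulr1.
Qed.

End BranchingRepresentation.

(** * The graded uniqueness theorem *)

Section GradedUniqueness.
Variables (R : comPzRingType) (E : graph).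
Local Notation L := (leavitt R E).

Lemma regular_or_sink (rfE : row_finite E) v : regular v \/ forall e : edge E, src e <> v.
Proof.
have [v0|] := pselect (out_edges v !=set0); first by left; split.
by move=> h; right=> e ev; apply: h; exists e.
Qed.

Lemma lvert_edgeM v e :
  lvert R v ** ledge R e = if v == src e then ledge R e else 0 :> L.
Proof.
rewrite -lvert_edge numulA lvertM; case: eqP => [->//|_].
by rewrite numul0r.
Qed.

Lemma lghost_vertM v e :
  lghost R e ** lvert R v = if src e == v then lghost R e else 0 :> L.
Proof.
rewrite -lghost_vert -numulA lvertM; case: eqP => // _.
by rewrite numulr0.
Qed.

Lemma walk_elt_walk_end v s :
  walk_elt R v s ** lvert R (walk_end v s) = walk_elt R v s :> L.
Proof.
elim: s v => [v|e s IH v]; first exact: lvertMid.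
by rewrite /= -numulA IH.
Qed.

Lemma walk_elt_edge e v s : walk v s ->
  walk_elt R v s ** ledge R e =
    if src e == walk_end v s then walk_elt R v (rcons s e) else 0 :> L.
Proof.
rewrite -{1}walk_elt_walk_end -lvert_edge -numulA (numulA (lvert _ _)) lvertM eq_sym.
case: eqVneq => [se w|]; last by rewrite numul0r numulr0.
rewrite -se lvert_edge; elim: s v w se => [|f s IH] v /=.
  by move=> _ sev; rewrite -[v]sev lvert_edge ledge_vert.
by move=> /andP[_ w] se; rewrite -numulA IH.
Qed.

Definition real_paths (n : nat) : set L := [set x | exists a v s,
  [/\ walk v s, size s = n & x = a *: walk_elt R v s]].

(** The bound n is a parameter for the induction that removes ghost edges. *)
Definition short_monos (k : int) (n : nat) : set L := [set x | exists a v s w t,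
  [/\ walk v s, walk w t, (size s)%:Z - (size t)%:Z = k, (size t <= n)%N
    & x = a *: (walk_elt R v s ** walk_star R w t)]].

Variables I J : ideal L.
Hypothesis rfE : row_finite E.
Hypothesis Jvert : forall (a : R) v,
  a != 0 -> ideal_set J (a *: lvert R v) -> ideal_set I (lvert R v).

(** If edges leave v, then v x is the sum of the e (e^* x) over these edges, and
    the paths of e^* x are one edge shorter; if none does, v x = 0 for n > 0. For
    n = 0, v x is a multiple of v that lies in J. *)
Lemma ideal_real_paths n x :
  addspan (real_paths n) x -> ideal_set J x -> ideal_set I x.
Proof.
elim: n x => [|n IH] x xn Jx.
  have vx v : exists a, lvert R v ** x = a *: lvert R v.
    elim: xn => [|_ y [a [w [s [_ /size0nil-> ->]]]] _ [b yb]] /=.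
      by exists 0; rewrite numulr0 scale0r.
    rewrite numulDr -nuscaleAr lvertM yb.
    case: eqP => _; first by exists (a + b); rewrite scalerDl.
    by exists b; rewrite scaler0 add0r.
  have [s ->] := leavitt_sum_left x; apply: ideal_sum_seq => v _.
  have := ideal_mull (lvert R v) Jx; have [a ->] := vx v => Jav.
  have [->|a0] := eqVneq a 0; first by rewrite scale0r; apply: ideal0.
  exact/leavitt_idealZ/Jvert/Jav.
have [s ->] := leavitt_sum_left x; apply: ideal_sum_seq => v _.
have [vreg|vsink] := regular_or_sink rfE v.
  rewrite lvert_reg // numul_suml; apply: ideal_sum_seq => e _.
  rewrite -numulA; apply/ideal_mull/IH; last exact: ideal_mull.
  move: x xn {Jx}; apply: addspan_morph => [x y|_ [a [w [[|f t] [wt tn ->]]]] //].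
    exact: numulDr.
  rewrite -nuscaleAr lghost_walk_elt //; case: eqP => [ef|_]; last first.
    by rewrite scaler0; apply: AddSpan0.
  apply: addspan1; exists a, (rng e), t; split=> //; last by case: tn.
  by case/andP: wt => _; rewrite ef.
suff -> : lvert R v ** x = 0 by apply: ideal0.
elim: xn => [|_ y [a [w [[|f t] [wt tn ->]]]] _ yb] //; first by rewrite numulr0.
rewrite numulDr -nuscaleAr yb lvert_walk_elt // addr0.
case/andP: wt => /eqP fw _; case: eqP => [vw|_]; last by rewrite scaler0.
by case: (vsink f); rewrite vw.
Qed.

(** If edges leave v, then x v is the sum of the (x e) e^* over these edges, and
    the ghost parts of x e are shorter; if none does, only the terms without
    ghost part survive in x v. *)
Lemma ideal_short_monos n k x :
  addspan (short_monos k n) x -> ideal_set J x -> ideal_set I x.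
Proof.
have base l y : addspan (short_monos l 0) y -> ideal_set J y -> ideal_set I y.
  move=> yl; apply: (@ideal_real_paths `|l|%N).
  move: y yl; apply: (@addspan_morph _ _ _ _ id) => // y.
  move=> [a [v [s [w [t [vs _ <- t0 ->]]]]]].
  move: t0; rewrite leqn0 => /nilP-> /=; rewrite addn0 -walk_elt_walk_end -numulA lvertM.
  case: eqP => _; last by rewrite numulr0 scaler0; apply: AddSpan0.
  by rewrite walk_elt_walk_end; apply: addspan1; exists a, v, s.
elim: n k x => [|n IH] k x xn Jx; first exact: base xn Jx.
have [s ->] := leavitt_sum_right x; apply: ideal_sum_seq => v _.
have [vreg|vsink] := regular_or_sink rfE v.
  rewrite lvert_reg // numul_sumr; apply: ideal_sum_seq => e _.
  rewrite numulA; apply/ideal_mulr/(IH (k + 1)); last exact: ideal_mulr.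
  move: x xn {Jx}; apply: (@addspan_morph _ _ _ _ (fun x => x ** ledge R e)) => [x y|].
    exact: numulDl.
  move=> _ [a [u [p [w [[|f t] [up wt <- tn ->]]]]]] /=; rewrite -nuscaleAl.
    rewrite subr0 -numulA lvert_edgeM; case: eqP => _; last first.
      by rewrite numulr0 scaler0; apply: AddSpan0.
    rewrite walk_elt_edge //.
    case: eqP => [eu|_]; last by rewrite scaler0; apply: AddSpan0.
    apply: addspan1; exists a, u, (rcons p e), (rng e), [::]; split=> //=.
    + by rewrite walk_rcons up eu eqxx.
    + by rewrite size_rcons subr0 intS addrC.
    + by rewrite -{1}walk_elt_walk_end /walk_end map_rcons last_rcons.
  rewrite -!numulA lghost_edge; case: eqP => [fe|_]; last first.
    by rewrite !numulr0 scaler0; apply: AddSpan0.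
  case/andP: wt => _ wt; rewrite walk_star_vert //.
  apply: addspan1; exists a, u, p, (rng f), t; split=> //.
  by rewrite intS opprD addrA addrAC addrNK.
apply: (base k); last exact: ideal_mulr.
move: x xn {Jx}; apply: (@addspan_morph _ _ _ _ (fun x => x ** lvert R v)) => [x y|].
  exact: numulDl.
move=> _ [a [u [p [w [[|f t] [up wt <- tn ->]]]]]] /=; rewrite -nuscaleAl.
  rewrite -numulA lvertM; case: eqP => _; last first.
    by rewrite numulr0 scaler0; apply: AddSpan0.
  by apply: addspan1; exists a, u, p, w, [::].
rewrite -!numulA lghost_vertM; case: eqP => [fv|_]; first by case: (vsink f).
by rewrite !numulr0 scaler0; apply: AddSpan0.
Qed.

(** The usual case is I = 0: a graded ideal J without nonzero multiples of
    vertices vanishes. With I the ideal generated by the vertices of J, the same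
    argument takes place modulo I. *)
Lemma graded_uniqueness k x :
  leavitt_deg k x -> ideal_set J x -> ideal_set I x.
Proof.
move=> xk; suff [n xn] : exists n, addspan (short_monos k n) x.
  exact: ideal_short_monos xn.
elim/leavitt_deg_ind: xk => {x} [|x y [n xn] [m ym]|a v s w t vs wt st].
- by exists 0%N; apply: AddSpan0.
- have widen l y' : (l <= n + m)%N -> addspan (short_monos k l) y' ->
      addspan (short_monos k (n + m)) y'.
    move=> lnm; move: y'; apply: (@addspan_morph _ _ _ _ id) => // z.
    move=> [a [v [s [w [t [vs wt st tl ->]]]]]]; apply: addspan1.
    by exists a, v, s, w, t; split=> //; apply: leq_trans lnm.
  exists (n + m)%N; apply: addspan_add; first exact: (widen n) (leq_addr _ _) xn.
  exact: (widen m) (leq_addl _ _) ym.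
by exists (size t); apply: addspan1; exists a, v, s, w, t.
Qed.

End GradedUniqueness.

Lemma leavitt_hom_eq (R : comPzRingType) (E : graph) (A : nuAlgType R)
    (f g : leavitt R E -> A) : nualg_hom f -> nualg_hom g ->
  (forall v, f (lvert R v) = g (lvert R v)) ->
  (forall e, f (ledge R e) = g (ledge R e)) ->
  (forall e, f (lghost R e) = g (lghost R e)) -> f =1 g.
Proof.
move=> hf hg fv fe fs; elim/leavitt_ind => [v|e|e||x h|x y hx hy|a x h|x y hx hy] //.
- by rewrite (nualg_hom0 hf) (nualg_hom0 hg).
- by rewrite (nualg_homN hf) (nualg_homN hg) h.
- by rewrite (nualg_homD hf) (nualg_homD hg) hx hy.
- by rewrite (nualg_homZ hf) (nualg_homZ hg) h.
- by rewrite (nualg_homM hf) (nualg_homM hg) hx hy.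
Qed.

(** * The vertices of an ideal *)

Section SaturatedSets.
Variable E : graph.
Implicit Types (H X : set (vert E)).

Lemma saturated_hereditaryI H1 H2 : saturated_hereditary H1 ->
  saturated_hereditary H2 -> saturated_hereditary (H1 `&` H2).
Proof.
move=> [h1 s1] [h2 s2]; split=> [e [/h1 ? /h2 ?]|v vreg sub]; first by split.
by split; [apply: s1|apply: s2] => // w /sub[].
Qed.

Lemma saturation_saturated X : saturated_hereditary (saturation X).
Proof.
split=> [e se H hH|v vreg sub H hH].
  by case: (hH) => [[hered _] _]; apply/hered/(se H hH).
by case: (hH) => [[_ sat] _]; apply: (sat v vreg) => w /sub/(_ H hH).
Qed.

Lemma sub_saturation X : X `<=` saturation X.
Proof. exact: sub_gen_smallest. Qed.

Lemma saturation_sub X H : saturated_hereditary H -> X `<=` H -> saturation X `<=` H.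
Proof. exact: smallest_sub. Qed.

End SaturatedSets.

Section VerticesOfIdeals.
Variables (R : comPzRingType) (E : graph).
Local Notation L := (leavitt R E).

Definition ideal_vertices (I : set L) : set (vert E) := [set v | I (lvert R v)].

(** Heredity comes from r(e) = e^* s(e) e, saturation from the expression of a
    regular vertex as the sum of the e r(e) e^*. *)
Lemma ideal_vertices_saturated (I : ideal L) :
  saturated_hereditary (ideal_vertices I).
Proof.
have rng_src e : ideal_vertices I (rng e) -> ideal_set I (ledge R e ** lghost R e).
  by move=> Ie; rewrite -ledge_vert -numulA; apply/ideal_mull/ideal_mulr.
split=> [e /= Ie|v vreg sub].
  have := lghost_edge R e e; rewrite eqxx -{1}lvert_edge /ideal_vertices /= => <-.
  by apply/ideal_mull/ideal_mulr.
rewrite /ideal_vertices /= lvert_reg //; apply: ideal_sum_seq => e.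
rewrite in_fset_set; last by case: vreg.
by move=> /set_mem ev; apply/rng_src/sub; exists e.
Qed.

Lemma mem_vert_ideal (X : set (vert E)) v : X v -> ideal_set (vert_ideal R X) (lvert R v).
Proof. by move=> Xv I [_]; apply; exists v. Qed.

Lemma vert_ideal_sub (X : set (vert E)) (I : set L) : is_ideal I ->
  X `<=` ideal_vertices I -> ideal_set (vert_ideal R X) `<=` I.
Proof.
move=> hI XI; apply: smallest_sub => // _ [v Xv <-].
exact: XI.
Qed.

End VerticesOfIdeals.

(** * The quotient by the ideal of a saturated hereditary set *)

Lemma leavitt_proj_hom (R : comPzRingType) (E : graph) (I : ideal (leavitt R E)) :
  nualg_hom (@leavitt_proj R E I).
Proof.
split=> [a x y|x y]; first by rewrite leavitt_proj_scale leavitt_proj_add.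
by rewrite leavitt_proj_mul.
Qed.

Lemma leavitt_proj0 (R : comPzRingType) (E : graph) (I : ideal (leavitt R E)) x :
  ideal_set I x -> leavitt_proj I x = 0.
Proof.
by move=> Ix; rewrite -(nualg_hom0 (leavitt_proj_hom I)); apply/quot_piP; rewrite subr0.
Qed.

Section RemovedGraph.
Variables (R : comPzRingType) (E : graph) (rfE : row_finite E).
Variables (H : set (vert E)) (hH : saturated_hereditary H).
Local Notation L := (leavitt R E).
Local Notation F := (graph_remove (proj1 hH)).
Local Notation I := (vert_ideal R H).

Lemma remove_row_finite : row_finite F.
Proof.
move=> v; apply: (@sub_finite_set _ _ (val @^-1` out_edges (val v))).
  by move=> e <-.
by apply: finite_preimage (rfE _) => e f _ _; apply: val_inj.
Qed.

Lemma remove_sum (A : nuRingType) (g : edge E -> A) (v : vert F) :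
  (forall e, H (rng e) -> g e = 0) ->
  \sum_(e \in out_edges v) g (val e) = \sum_(e \in out_edges (val v)) g e.
Proof.
move=> g0.
rewrite -(@fsbig_widen _ _ _ _
  (out_edges (val v) `&` [set e | ~ H (rng e)])); last 2 first.
- by move=> e [].
- move=> e [/= ev nev]; apply: g0; apply: contrapT => He; exact: nev.
symmetry; apply: reindex_fsbig; split=> [e <- /=|e f _ _|e [/= ev He]].
- by split=> //=; case: e => e /= /set_mem.
- exact: val_inj.
by exists (exist _ e (mem_set (He : (~` H) (rng e)))) => //; apply: val_inj.
Qed.

(** Here saturation is used: if all the edges out of a regular vertex ended in
    H, the vertex would be in H. *)
Lemma remove_regular (v : vert F) : regular (val v) <-> regular v.
Proof.
split=> [vreg|[[e <-] _]]; last by split=> //; exists (val e).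
split; last exact: remove_row_finite.
have : ~ (@rng E @` out_edges (val v) `<=` H).
  move=> sub; have /set_mem := valP v; apply.
  by case: hH => _; apply.
move=> /existsNP[_ /not_implyP[[e ev <-] He]].
by exists (exist _ e (mem_set (He : (~` H) (rng e)))); apply: val_inj.
Qed.

Lemma quot_family_subproof : is_leavitt_family
  (fun v : vert F => leavitt_proj I (lvert R (val v)))
  (fun e : edge F => leavitt_proj I (ledge R (val e)))
  (fun e : edge F => leavitt_proj I (lghost R (val e))).
Proof.
have h0 := nualg_hom0 (leavitt_proj_hom I).
split=> [v w|e|e|e f|v vreg]; rewrite ?leavitt_proj_mul.
- by rewrite lvertM val_eqE; case: eqP.
- by rewrite lvert_edge ledge_vert.
- by rewrite lvert_ghost lghost_vert.
- by rewrite lghost_edge val_eqE; case: eqP.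
rewrite (remove_sum
  (g := fun e => leavitt_proj I (ledge R e) ** leavitt_proj I (lghost R e))).
  rewrite lvert_reg; last exact/remove_regular.
  rewrite (nualg_hom_sum (leavitt_proj_hom I)) fsbig_finite; last exact: rfE.
  by apply: eq_bigr => e _; rewrite leavitt_proj_mul.
move=> e He; rewrite leavitt_proj_mul leavitt_proj0 //.
by rewrite -ledge_vert -numulA; apply/ideal_mull/ideal_mulr; apply: mem_vert_ideal.
Qed.

Definition quot_family := LeavittFamily quot_family_subproof.

(** The generators of the large graph, as elements of the small algebra; those
    that disappear from the graph become 0. *)
Definition kill_vert (v : vert E) : leavitt R F := 
  oapp (@lvert R F) 0 (insub v : option {v : vert E | v \in ~` H}).
Definition kill_edge (e : edge E) : leavitt R F := 
  oapp (@ledge R F) 0 (insub e : option {e : edge E | rng e \in ~` H}).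
Definition kill_ghost (e : edge E) : leavitt R F := 
  oapp (@lghost R F) 0 (insub e : option {e : edge E | rng e \in ~` H}).

Lemma kill_vert_val (v : vert F) : kill_vert (val v) = lvert R v.
Proof. by rewrite /kill_vert valK. Qed.
Lemma kill_edge_val (e : edge F) : kill_edge (val e) = ledge R e.
Proof. by rewrite /kill_edge valK. Qed.
Lemma kill_ghost_val (e : edge F) : kill_ghost (val e) = lghost R e.
Proof. by rewrite /kill_ghost valK. Qed.
Lemma kill_vert0 v : H v -> kill_vert v = 0.
Proof. by move=> Hv; rewrite /kill_vert insubN //; apply/negP => /set_mem; apply. Qed.
Lemma kill_edge0 e : H (rng e) -> kill_edge e = 0.
Proof. by move=> Hv; rewrite /kill_edge insubN //; apply/negP => /set_mem; apply. Qed.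
Lemma kill_ghost0 e : H (rng e) -> kill_ghost e = 0.
Proof. by move=> Hv; rewrite /kill_ghost insubN //; apply/negP => /set_mem; apply. Qed.

Lemma remove_vertP v : H v \/ exists w : vert F, val w = v.
Proof.
have [Hv|Hv] := pselect (H v); [by left|right].
by exists (exist _ v (mem_set (Hv : (~` H) v))).
Qed.
Lemma remove_edgeP e : H (rng e) \/ exists f : edge F, val f = e.
Proof.
have [He|He] := pselect (H (rng e)); [by left|right].
by exists (exist _ e (mem_set (He : (~` H) (rng e)))).
Qed.

Lemma kill_family_subproof : is_leavitt_family kill_vert kill_edge kill_ghost.
Proof.
have vsrc (e : edge F) : kill_vert (src (val e)) = lvert R (src e).
  exact: (kill_vert_val (src e)).
have vrng (e : edge F) : kill_vert (rng (val e)) = lvert R (rng e).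
  exact: (kill_vert_val (rng e)).
split=> [v w|e|e|e f|v vreg].
- have [Hv|[{}v <-]] := remove_vertP v.
    by rewrite kill_vert0 // numul0r; case: eqP.
  have [Hw|[{}w <-]] := remove_vertP w.
    by rewrite (kill_vert0 Hw) numulr0; case: eqP => // ->; rewrite kill_vert0.
  by rewrite !kill_vert_val lvertM val_eqE.
- have [He|[{}e <-]] := remove_edgeP e.
    by rewrite kill_edge0 // numul0r numulr0.
  by rewrite vsrc vrng kill_edge_val lvert_edge ledge_vert.
- have [He|[{}e <-]] := remove_edgeP e.
    by rewrite kill_ghost0 // numul0r numulr0.
  by rewrite vsrc vrng kill_ghost_val lvert_ghost lghost_vert.
- have [He|[{}e <-]] := remove_edgeP e.
    by rewrite kill_ghost0 // numul0r kill_vert0 //; case: eqP.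
  have [Hf|[{}f <-]] := remove_edgeP f.
    rewrite (kill_edge0 Hf) numulr0; case: eqP => // ef.
    by rewrite kill_vert0 // ef.
  by rewrite kill_edge_val kill_ghost_val lghost_edge val_eqE vrng.
have [Hv|[w wv]] := remove_vertP v.
  rewrite kill_vert0 // fsbig1 // => e ev; rewrite kill_edge0 ?numul0r //.
  by apply: (proj1 hH); rewrite ev.
rewrite -wv in vreg *.
rewrite -(remove_sum (g := fun e => kill_edge e ** kill_ghost e)) => [|e He].
  have wreg : regular w by apply/remove_regular.
  rewrite kill_vert_val lvert_reg // -fsbig_finite; last by case: wreg.
  by apply: eq_fsbigr => e _; rewrite kill_edge_val kill_ghost_val.
by rewrite kill_edge0 // numul0r.
Qed.

Definition kill_family := LeavittFamily kill_family_subproof.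
Local Notation kill := (leavitt_lift kill_family).

Lemma kill_ideal x : ideal_set I x -> kill x = 0.
Proof.
apply: (vert_ideal_sub (is_ideal_ker (leavitt_lift_hom kill_family))) => v Hv.
by rewrite /ideal_vertices /= leavitt_lift_vert /= kill_vert0.
Qed.

(** Sending to 0 the generators that disappear induces a map on the quotient,
    because its kernel contains H; it is inverse to the map given by the classes
    of generators, as one sees on generators. *)
Lemma quot_removeP : exists phi : leavitt R F -> leavitt_quot I,
  [/\ nualg_hom phi, bijective phi,
      forall v, phi (lvert R v) = leavitt_proj I (lvert R (val v)),
      forall e, phi (ledge R e) = leavitt_proj I (ledge R (val e))
    & forall e, phi (lghost R e) = leavitt_proj I (lghost R (val e))].
Proof.
have kh := leavitt_lift_hom kill_family.
have ph := leavitt_lift_hom quot_family.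
pose psi (q : leavitt_quot I) := kill (repr q).
have psiE x : psi (leavitt_proj I x) = kill x.
  apply/eqP; rewrite -subr_eq0 -(nualg_homB kh); apply/eqP/kill_ideal.
  exact: quot_repr.
have psih : nualg_hom psi.
  split=> [a p q|p q]; elim/leavitt_quot_ind: p => x; elim/leavitt_quot_ind: q => y.
    by rewrite leavitt_proj_scale leavitt_proj_add !psiE (nualg_homZD kh).
  by rewrite leavitt_proj_mul !psiE (nualg_homM kh).
exists (leavitt_lift quot_family); split=> // [|v|e|e].
- exists psi.
    apply: leavitt_hom_eq => [||v|e|e] /=.
    + exact: nualg_hom_comp ph psih.
    + by split.
    + by rewrite leavitt_lift_vert psiE leavitt_lift_vert /= kill_vert_val.
    + by rewrite leavitt_lift_edge psiE leavitt_lift_edge /= kill_edge_val.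
    + by rewrite leavitt_lift_ghost psiE leavitt_lift_ghost /= kill_ghost_val.
  elim/leavitt_quot_ind => x; rewrite psiE; move: x.
  have I0 (e : edge E) : H (rng e) ->
      ideal_set I (ledge R e) /\ ideal_set I (lghost R e).
    move=> He; rewrite -ledge_vert -lvert_ghost.
    by split; [apply: ideal_mull|apply: ideal_mulr]; apply: mem_vert_ideal.
  apply: (leavitt_hom_eq (nualg_hom_comp kh ph) (leavitt_proj_hom I)) => [v|e|e] /=.
  + rewrite leavitt_lift_vert /=; have [Hv|[w <-]] := remove_vertP v.
      by rewrite kill_vert0 // (nualg_hom0 ph) leavitt_proj0 //; apply: mem_vert_ideal.
    by rewrite kill_vert_val leavitt_lift_vert.
  + rewrite leavitt_lift_edge /=; have [He|[f <-]] := remove_edgeP e.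
      by rewrite kill_edge0 // (nualg_hom0 ph) leavitt_proj0 //; case: (I0 e).
    by rewrite kill_edge_val leavitt_lift_edge.
  + rewrite leavitt_lift_ghost /=; have [He|[f <-]] := remove_edgeP e.
      by rewrite kill_ghost0 // (nualg_hom0 ph) leavitt_proj0 //; case: (I0 e).
    by rewrite kill_ghost_val leavitt_lift_ghost.
- exact: leavitt_lift_vert.
- exact: leavitt_lift_edge.
- exact: leavitt_lift_ghost.
Qed.

(** The map to the algebra of the small graph kills the ideal and keeps a v for v
    outside H, and there vertices have no torsion. *)
Lemma scale_vert_ideal a v : a != 0 -> ideal_set I (a *: lvert R v) -> H v.
Proof.
have kh := leavitt_lift_hom kill_family.
move=> a0 /kill_ideal; rewrite (nualg_homZ kh) leavitt_lift_vert /=.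
have [//|[w <-]] := remove_vertP v.
rewrite kill_vert_val => /(scale_lvert_eq0 remove_row_finite) aE.
by rewrite aE eqxx in a0.
Qed.

End RemovedGraph.

(** * The lattice of graded basic ideals *)

Section GradedBasicLattice.
Variables (R : comNzRingType) (E : graph) (rfE : row_finite E).
Local Notation L := (leavitt R E).
Implicit Types (H : set (vert E)) (I J : set L).

Lemma vert_ideal_graded_basic H :
  saturated_hereditary H -> graded_basic_ideal (vert_ideal R H).
Proof.
move=> hH; split; [exact: idealP|exact: vert_ideal_graded|move=> a v a0 Iav].
by apply: mem_vert_ideal; apply: scale_vert_ideal Iav.
Qed.

Lemma ideal_vertices_vert_ideal H :
  saturated_hereditary H -> ideal_vertices (vert_ideal R H) = H.
Proof.
move=> hH; apply/seteqP; split=> v; last exact: mem_vert_ideal.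
rewrite /ideal_vertices /= -[lvert R v]scale1r.
exact: (scale_vert_ideal rfE hH (oner_neq0 R)).
Qed.

Lemma graded_basic_saturated I :
  graded_basic_ideal I -> saturated_hereditary (ideal_vertices I).
Proof. by case=> hI _ _; apply: (ideal_vertices_saturated (Ideal hI)). Qed.

(** Since I is basic, its multiples of vertices are multiples of vertices of I:
    this is the hypothesis of graded uniqueness for I over the ideal generated
    by its vertices. *)
Lemma graded_basic_vert_ideal I :
  graded_basic_ideal I -> ideal_set (vert_ideal R (ideal_vertices I)) = I.
Proof.
move=> [hI gI bI]; apply/seteqP; split; first exact: vert_ideal_sub.
move=> x /((gradedP hI).1 gI); elim=> [|y z [Iy [k yk]] _ Iz]; first exact: ideal0.
apply: idealD Iz; apply: (@graded_uniqueness _ _ _ (Ideal hI) _ _ k) => //.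
move=> a v a0 /= Iav; apply: mem_vert_ideal.
exact: bI Iav.
Qed.

Lemma vert_ideal_le H1 H2 : saturated_hereditary H1 -> saturated_hereditary H2 ->
  H1 `<=` H2 <-> ideal_set (vert_ideal R H1) `<=` ideal_set (vert_ideal R H2).
Proof.
move=> h1 h2; split=> [sub|sub v Hv].
  by apply: vert_ideal_sub => [|v /sub]; [apply: idealP|apply: mem_vert_ideal].
by rewrite -(ideal_vertices_vert_ideal h2); apply: sub; apply: mem_vert_ideal.
Qed.

Lemma graded_basicI I J :
  graded_basic_ideal I -> graded_basic_ideal J -> graded_basic_ideal (I `&` J).
Proof.
move=> [hI gI bI] [hJ gJ bJ]; have hIJ := is_idealI hI hJ; split=> //.
  by apply/(gradedP hIJ) => x [Ix Jx]; apply: gradedI.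
by move=> a v a0 [Iav Jav]; split; [apply: bI Iav|apply: bJ Jav].
Qed.

Lemma is_ideal_sum I J : is_ideal I -> is_ideal J -> is_ideal (ideal_sum I J).
Proof.
move=> [I0 IB Il Ir] [J0 JB Jl Jr]; split.
- by exists 0 => //; exists 0 => //; rewrite addr0.
- move=> _ _ [x Ix [y Jy <-]] [x' Ix' [y' Jy' <-]].
  exists (x - x'); first exact: IB.
  by exists (y - y'); [apply: JB|rewrite opprD addrACA].
- move=> a _ [x Ix [y Jy <-]]; exists (a ** x); first exact: Il.
  by exists (a ** y); [apply: Jl|rewrite numulDr].
- move=> _ a [x Ix [y Jy <-]]; exists (x ** a); first exact: Ir.
  by exists (y ** a); [apply: Jr|rewrite numulDl].
Qed.

Lemma ideal_suml I J : is_ideal J -> I `<=` ideal_sum I J.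
Proof. by move=> [J0 _ _ _] x Ix; exists x => //; exists 0; rewrite ?addr0. Qed.
Lemma ideal_sumr I J : is_ideal I -> J `<=` ideal_sum I J.
Proof. by move=> [I0 _ _ _] x Ix; exists 0 => //; exists x; rewrite ?add0r. Qed.
Lemma ideal_sum_sub I J K : is_ideal K -> I `<=` K -> J `<=` K -> ideal_sum I J `<=` K.
Proof.
by move=> hK IK JK _ [x /IK Kx [y /JK Ky <-]]; apply: (@idealD _ (Ideal hK)).
Qed.

Lemma vert_idealI H1 H2 : saturated_hereditary H1 -> saturated_hereditary H2 ->
  ideal_set (vert_ideal R H1) `&` ideal_set (vert_ideal R H2)
    = ideal_set (vert_ideal R (H1 `&` H2)).
Proof.
move=> h1 h2; have g12 := graded_basicI (vert_ideal_graded_basic h1)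
  (vert_ideal_graded_basic h2).
rewrite -(graded_basic_vert_ideal g12); congr (ideal_set (vert_ideal R _)).
rewrite -{2}(ideal_vertices_vert_ideal h1) -{2}(ideal_vertices_vert_ideal h2).
by [].
Qed.

(** The vertices of the sum form a saturated hereditary set, hence include the
    saturation of the union. *)
Lemma vert_ideal_sum H1 H2 :
  ideal_sum (ideal_set (vert_ideal R H1)) (ideal_set (vert_ideal R H2))
    = ideal_set (vert_ideal R (saturation (H1 `|` H2))).
Proof.
have i1 := idealP (vert_ideal R H1); have i2 := idealP (vert_ideal R H2).
apply/seteqP; split.
  apply: ideal_sum_sub; first exact: idealP.
    by apply: vert_ideal_sub => [|v Hv]; [apply: idealP|
      apply: mem_vert_ideal; apply: sub_saturation; left].
  by apply: vert_ideal_sub => [|v Hv]; [apply: idealP|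
    apply: mem_vert_ideal; apply: sub_saturation; right].
have i12 := is_ideal_sum i1 i2.
apply: vert_ideal_sub => //; apply: saturation_sub.
  exact: (ideal_vertices_saturated (Ideal i12)).
by move=> v [Hv|Hv]; [apply: ideal_suml => //|apply: ideal_sumr => //];
  apply: mem_vert_ideal.
Qed.

Lemma graded_basic_sum I J :
  graded_basic_ideal I -> graded_basic_ideal J -> graded_basic_ideal (ideal_sum I J).
Proof.
move=> /graded_basic_vert_ideal <- /graded_basic_vert_ideal <-.
rewrite vert_ideal_sum; apply/vert_ideal_graded_basic/saturation_saturated.
Qed.

Lemma saturated_hereditary_lattice :
  set_lattice (@saturated_hereditary E) setI (fun H1 H2 => saturation (H1 `|` H2)).
Proof.
move=> H1 H2 h1 h2; split.
- exact: saturated_hereditaryI.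
- exact: saturation_saturated.
- by split=> [||K _]; [apply: subIsetl|apply: subIsetr|rewrite subsetI].
- split=> [||K hK K1 K2].
  + by apply: subset_trans (@sub_saturation _ _); apply: subsetUl.
  + by apply: subset_trans (@sub_saturation _ _); apply: subsetUr.
  + by apply: saturation_sub => //; rewrite subUset.
Qed.

Lemma graded_basic_lattice :
  set_lattice (@graded_basic_ideal R E) setI (@ideal_sum R E).
Proof.
move=> I J gI gJ; have [hI _ _] := gI; have [hJ _ _] := gJ; split.
- exact: graded_basicI.
- exact: graded_basic_sum.
- by split=> [||K _]; [apply: subIsetl|apply: subIsetr|rewrite subsetI].
- split=> [||K [hK _ _]]; [exact: ideal_suml|exact: ideal_sumr|].
  exact: ideal_sum_sub.
Qed.

Lemma vert_ideal_lattice_iso :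
  set_lattice_iso
    (@saturated_hereditary E) setI (fun H1 H2 => saturation (H1 `|` H2))
    (@graded_basic_ideal R E) setI (@ideal_sum R E)
    (fun H => ideal_set (vert_ideal R H)).
Proof.
split=> [|H1 H2|H1 H2 h1 h2|H1 H2 h1 h2].
- split=> [H hH|H1 H2 /set_mem h1 /set_mem h2 e12|I gI].
  + exact: vert_ideal_graded_basic.
  + by rewrite -(ideal_vertices_vert_ideal h1) e12 ideal_vertices_vert_ideal.
  + exists (ideal_vertices I); first exact: graded_basic_saturated.
    exact: graded_basic_vert_ideal.
- exact: vert_ideal_le.
- by rewrite vert_idealI.
- by rewrite vert_ideal_sum.
Qed.

End GradedBasicLattice.

(** * Morita contexts inside a ring *)

(** An additive subgroup of a ring A on which two rings act by multiplication
    in A, through homomorphisms to A. *)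
Record subbimod (T S A : nuRingType) := SubBimod {
  sb_set : set A;
  sb_left : T -> A;
  sb_right : S -> A;
  sb_set0 : sb_set 0;
  sb_setB : forall x y, sb_set x -> sb_set y -> sb_set (x - y);
  sb_leftD : {morph sb_left : x y / x + y};
  sb_leftM : {morph sb_left : x y / x ** y};
  sb_rightD : {morph sb_right : x y / x + y};
  sb_rightM : {morph sb_right : x y / x ** y};
  sb_lact : forall t x, sb_set x -> sb_set (sb_left t ** x);
  sb_ract : forall x s, sb_set x -> sb_set (x ** sb_right s)
}.

Section SubBimodule.
Variables (T S A : nuRingType) (d : subbimod T S A).

Definition sb_pred : {pred A} := fun x => `[< sb_set d x >].

Lemma sb_predP x : reflect (sb_set d x) (x \in sb_pred).
Proof. exact: asboolP. Qed.

Lemma sb_zmod_closed : zmod_closed sb_pred.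
Proof.
split; first exact/sb_predP/sb_set0.
by move=> x y /sb_predP dx /sb_predP dy; apply/sb_predP/sb_setB.
Qed.

HB.instance Definition _ := GRing.isZmodClosed.Build A sb_pred sb_zmod_closed.

Record sbmod := SbMod { sb_val : A; sb_valP : sb_val \in sb_pred }.

HB.instance Definition _ := [isSub for sb_val].
HB.instance Definition _ := [Choice of sbmod by <:].
HB.instance Definition _ := [SubChoice_isSubZmodule of sbmod by <:].

Lemma sb_valD (x y : sbmod) : sb_val (x + y) = sb_val x + sb_val y.
Proof. by []. Qed.

Lemma sb_lact_subproof t (x : sbmod) : sb_left d t ** sb_val x \in sb_pred.
Proof. exact/sb_predP/sb_lact/sb_predP/sb_valP. Qed.
Lemma sb_ract_subproof (x : sbmod) s : sb_val x ** sb_right d s \in sb_pred.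
Proof. exact/sb_predP/sb_ract/sb_predP/sb_valP. Qed.

Definition sbmod_lact t x : sbmod := SbMod (sb_lact_subproof t x).
Definition sbmod_ract x s : sbmod := SbMod (sb_ract_subproof x s).

Lemma sbmod_lactA t u m : sbmod_lact t (sbmod_lact u m) = sbmod_lact (t ** u) m.
Proof. by apply: val_inj; rewrite /= sb_leftM numulA. Qed.
Lemma sbmod_ractA m s u : sbmod_ract (sbmod_ract m s) u = sbmod_ract m (s ** u).
Proof. by apply: val_inj; rewrite /= sb_rightM numulA. Qed.
Lemma sbmod_lractA t m s : sbmod_lact t (sbmod_ract m s) = sbmod_ract (sbmod_lact t m) s.
Proof. by apply: val_inj; rewrite /= numulA. Qed.
Lemma sbmod_lactDl m : {morph sbmod_lact^~ m : t u / t + u}.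
Proof. by move=> t u; apply: val_inj; rewrite /= sb_leftD numulDl. Qed.
Lemma sbmod_lactDr t : {morph sbmod_lact t : m n / m + n}.
Proof. by move=> m n; apply: val_inj; rewrite /= numulDr. Qed.
Lemma sbmod_ractDl s : {morph sbmod_ract^~ s : m n / m + n}.
Proof. by move=> m n; apply: val_inj; rewrite /= numulDl. Qed.
Lemma sbmod_ractDr m : {morph sbmod_ract m : s u / s + u}.
Proof. by move=> s u; apply: val_inj; rewrite /= sb_rightD numulDr. Qed.

HB.instance Definition _ := Zmodule_isBimod.Build T S sbmod
  sbmod_lactA sbmod_ractA sbmod_lractA
  sbmod_lactDl sbmod_lactDr sbmod_ractDl sbmod_ractDr.

Lemma sb_val_lact t (x : sbmod) : sb_val (lact t x) = sb_left d t ** sb_val x.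
Proof. by []. Qed.
Lemma sb_val_ract (x : sbmod) s : sb_val (ract x s) = sb_val x ** sb_right d s.
Proof. by []. Qed.

Lemma sb_val_inj : injective sb_val. Proof. exact: val_inj. Qed.

Lemma sb_valS (x : sbmod) : sb_set d (sb_val x).
Proof. exact/sb_predP/sb_valP. Qed.

Lemma sb_valE a : sb_set d a -> exists x : sbmod, sb_val x = a.
Proof. by move=> /sb_predP da; exists (SbMod da). Qed.

Lemma sbmod_unital :
  (forall x, sb_set d x ->
    addspan [set y | exists t a, sb_set d a /\ y = sb_left d t ** a] x) ->
  (forall x, sb_set d x ->
    addspan [set y | exists a s, sb_set d a /\ y = a ** sb_right d s] x) ->
  unital_bimod sbmod.
Proof.
move=> hl hr; split=> m.
  have [s ms] : exists s : seq (T * sbmod),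
      sb_val m = sb_val (\sum_(p <- s) lact p.1 p.2).
    elim: (hl _ (sb_valS m)) => [|_ y [t [a [da ->]]] _ [s ->]].
      by exists [::]; rewrite big_nil.
    by have [x <-] := sb_valE da; exists ((t, x) :: s); rewrite big_cons.
  by exists s; apply: sb_val_inj.
have [s ms] : exists s : seq (sbmod * S),
    sb_val m = sb_val (\sum_(p <- s) ract p.1 p.2).
  elim: (hr _ (sb_valS m)) => [|_ y [a [t [da ->]]] _ [s ->]].
    by exists [::]; rewrite big_nil.
  by have [x <-] := sb_valE da; exists ((x, t) :: s); rewrite big_cons.
by exists s; apply: sb_val_inj.
Qed.

End SubBimodule.

Lemma tensor_tens_ind (T S U : nuRingType) (M : bimodType T S) (N : bimodType S U)
    (P : tensor M N -> Prop) : P 0 -> (forall x y, P x -> P y -> P (x + y)) ->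
  (forall m n, P (tens m n)) -> forall x, P x.
Proof.
move=> P0 PD Pt; elim/tensor_pi_ind; elim=> [|[m n] s IH]; first exact: P0.
have -> : \pi_(tensor M N)%qT ((m, n) :: s) = tens m n + \pi_(tensor M N)%qT s.
  by rewrite [RHS]tensor_addE.
exact: PD.
Qed.

Lemma lact0 (T S : nuRingType) (M : bimodType T S) t : lact t (0 : M) = 0.
Proof. by apply: (addrI (lact t 0)); rewrite -lactDr !addr0. Qed.

Lemma ract0 (T S : nuRingType) (M : bimodType T S) s : ract (0 : M) s = 0.
Proof. by apply: (addrI (ract 0 s)); rewrite -ractDl !addr0. Qed.

Lemma lact_tens (T S U : nuRingType) (M : bimodType T S) (N : bimodType S U) t
    (m : M) (n : N) : lact t (tens m n) = tens (lact t m) n.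
Proof. exact: tensor_lactE. Qed.

Lemma ract_tens (T S U : nuRingType) (M : bimodType T S) (N : bimodType S U) u
    (m : M) (n : N) : ract (tens m n) u = tens m (ract n u).
Proof. exact: tensor_ractE. Qed.

(** The product in A of an element of M and one of N lies in T; its additivity,
    balance and linearity are laws of the ring A. *)
Lemma sbmod_pairing (T S A : nuRingType) (dM : subbimod T S A) (dN : subbimod S T A) :
  sb_right dM = sb_left dN -> sb_left dM = sb_right dN -> injective (sb_left dM) ->
  (forall m n, sb_set dM m -> sb_set dN n -> exists t, sb_left dM t = m ** n) ->
  (forall t, addspan [set y | exists m n,
     [/\ sb_set dM m, sb_set dN n & y = m ** n]] (sb_left dM t)) ->
  exists psi : {additive tensor (sbmod dM) (sbmod dN) -> T},
  [/\ forall m n, sb_left dM (psi (tens m n)) = sb_val m ** sb_val n,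
      forall t x, psi (lact t x) = t ** psi x,
      forall x t, psi (ract x t) = psi x ** t
    & forall t, exists x, psi x = t].
Proof.
move=> eqS eqT inj mul span.
pose f (m : sbmod dM) (n : sbmod dN) := sval (cid (mul _ _ (sb_valS m) (sb_valS n))).
have fE m n : sb_left dM (f m n) = sb_val m ** sb_val n.
  exact: (svalP (cid (mul _ _ (sb_valS m) (sb_valS n)))).
have fb : balanced f.
  split=> [n m m'|m n n'|m s n]; apply: inj; rewrite ?sb_leftD !fE ?sb_valD.
  - by rewrite numulDl.
  - by rewrite numulDr.
  - by rewrite sb_val_ract sb_val_lact eqS numulA.
have [psi psiE _] := tensor_lift fb.
have psiD := raddfD psi; have psi0 := raddf0 psi.
have psiV m n : sb_left dM (psi (tens m n)) = sb_val m ** sb_val n by rewrite psiE.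
exists psi; split=> // [t|x t|t].
- apply: tensor_tens_ind => [|x y hx hy|m n].
  + by rewrite lact0 psi0 numulr0.
  + by rewrite lactDr !psiD hx hy numulDr.
  + by rewrite lact_tens; apply: inj; rewrite sb_leftM !psiV sb_val_lact numulA.
- move: x; apply: tensor_tens_ind => [|x y hx hy|m n].
  + by rewrite ract0 psi0 numul0r.
  + by rewrite ractDl !psiD hx hy numulDl.
  + by rewrite ract_tens; apply: inj; rewrite sb_leftM !psiV sb_val_ract numulA eqT.
suff [x xt] : exists x, sb_left dM (psi x) = sb_left dM t by exists x; apply: inj.
elim: (span t) => [|_ y [m [n [dm dn ->]]] _ [x <-]].
  exists 0; rewrite psi0; apply: (addrI (sb_left dM 0)).
  by rewrite -sb_leftD !addr0.
have [m' <-] := sb_valE dm; have [n' <-] := sb_valE dn.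
by exists (tens m' n' + x); rewrite psiD sb_leftD psiV.
Qed.

Section CornerContext.
Variables (T S A : nuRingType) (dM : subbimod T S A) (dN : subbimod S T A).
Hypotheses (eqS : sb_right dM = sb_left dN) (eqT : sb_left dM = sb_right dN).
Hypotheses (injT : injective (sb_left dM)) (injS : injective (sb_left dN)).
Hypothesis mulMN : forall m n,
  sb_set dM m -> sb_set dN n -> exists t, sb_left dM t = m ** n.
Hypothesis mulNM : forall n m,
  sb_set dN n -> sb_set dM m -> exists s, sb_left dN s = n ** m.
Hypothesis spanMN : forall t, addspan [set y | exists m n,
  [/\ sb_set dM m, sb_set dN n & y = m ** n]] (sb_left dM t).
Hypothesis spanNM : forall s, addspan [set y | exists n m,
  [/\ sb_set dN n, sb_set dM m & y = n ** m]] (sb_left dN s).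
Hypothesis spanM : forall m, sb_set dM m -> addspan [set y | exists m' n m'',
  [/\ sb_set dM m', sb_set dN n, sb_set dM m'' & y = m' ** n ** m'']] m.
Hypothesis spanN : forall n, sb_set dN n -> addspan [set y | exists n' m n'',
  [/\ sb_set dN n', sb_set dM m, sb_set dN n'' & y = n' ** m ** n'']] n.

(** From m = m' n m'', with m' n in T and n m'' in S. *)
Lemma corner_unitalM : unital_bimod (sbmod dM).
Proof.
apply: sbmod_unital => x /spanM; apply: (@addspan_morph _ _ _ _ id) => //.
  move=> _ [m [n [m' [dm dn dm' ->]]]]; apply: addspan1.
  by have [t <-] := mulMN dm dn; exists t, m'.
move=> _ [m [n [m' [dm dn dm' ->]]]]; apply: addspan1.
by have [s se] := mulNM dn dm'; exists m, s; rewrite eqS se numulA.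
Qed.

Lemma corner_idempotent : idempotent_ring T.
Proof.
move=> t; suff [s ts] : exists s : seq (T * T),
    sb_left dM t = sb_left dM (\sum_(p <- s) p.1 ** p.2).
  by exists s; apply: injT.
have : addspan [set y | exists a b, y = sb_left dM (a ** b)] (sb_left dM t).
  move: (spanMN t); apply: (@addspan_morph _ _ _ _ id) => // _ [m [n [dm dn ->]]].
  move: (spanM dm); apply: (@addspan_morph _ _ _ _ (fun x => x ** n)) => [x y|].
    exact: numulDl.
  move=> _ [m1 [n1 [m2 [dm1 dn1 dm2 ->]]]]; apply: addspan1.
  have [a aE] := mulMN dm1 dn1; have [b bE] := mulMN dm2 dn.
  by exists a, b; rewrite sb_leftM aE bE !numulA.
elim=> [|_ y [a [b ->]] _ [s ->]].
  exists [::]; rewrite big_nil; apply: (addrI (sb_left dM 0)).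
  by rewrite -sb_leftD !addr0.
by exists ((a, b) :: s); rewrite big_cons sb_leftD.
Qed.

End CornerContext.

(** For subgroups M and N of A with T = MN, S = NM, M = MNM and N = NMN, the
    compatibility of the two pairings is associativity in A. *)
Lemma corner_morita (T S A : nuRingType) (dM : subbimod T S A) (dN : subbimod S T A) :
  sb_right dM = sb_left dN -> sb_left dM = sb_right dN ->
  injective (sb_left dM) -> injective (sb_left dN) ->
  (forall m n, sb_set dM m -> sb_set dN n -> exists t, sb_left dM t = m ** n) ->
  (forall n m, sb_set dN n -> sb_set dM m -> exists s, sb_left dN s = n ** m) ->
  (forall t, addspan [set y | exists m n,
     [/\ sb_set dM m, sb_set dN n & y = m ** n]] (sb_left dM t)) ->
  (forall s, addspan [set y | exists n m,
     [/\ sb_set dN n, sb_set dM m & y = n ** m]] (sb_left dN s)) ->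
  (forall m, sb_set dM m -> addspan [set y | exists m' n m'',
     [/\ sb_set dM m', sb_set dN n, sb_set dM m'' & y = m' ** n ** m'']] m) ->
  (forall n, sb_set dN n -> addspan [set y | exists n' m n'',
     [/\ sb_set dN n', sb_set dM m, sb_set dN n'' & y = n' ** m ** n'']] n) ->
  morita_equivalent T S.
Proof.
move=> eqS eqT injT injS mulMN mulNM spanMN spanNM spanM spanN.
split; [exact: (@corner_idempotent _ _ _ dM dN)|exact: (@corner_idempotent _ _ _ dN dM)|].
have [psi [psiE psil psir psis]] := sbmod_pairing eqS eqT injT mulMN spanMN.
have [phi [phiE phil phir phis]] :=
  sbmod_pairing (esym eqT) (esym eqS) injS mulNM spanNM.
constructor; apply: (@MoritaContext T S (sbmod dM) (sbmod dN) psi phi) => //.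
- exact: (@corner_unitalM _ _ _ dM dN).
- exact: (@corner_unitalM _ _ _ dN dM).
- move=> n m n'; apply: sb_val_inj.
  by rewrite sb_val_lact sb_val_ract phiE -eqT psiE numulA.
- move=> m' n m; apply: sb_val_inj.
  by rewrite sb_val_lact sb_val_ract eqS phiE psiE numulA.
Qed.

(** * The ideal of a hereditary set *)

Section RestrictedGraph.
Variables (R : comNzRingType) (E : graph) (rfE : row_finite E).
Variables (X : set (vert E)) (hX : hereditary X).
Local Notation L := (leavitt R E).
Local Notation F := (graph_restrict hX).
Local Notation I := (vert_ideal R X).

Lemma restrict_row_finite : row_finite F.
Proof.
move=> v; apply: (@sub_finite_set _ _ (val @^-1` out_edges (val v))).
  by move=> e <-.
by apply: finite_preimage (rfE _) => e f _ _; apply: val_inj.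
Qed.

Lemma restrict_sum (A : nuRingType) (g : edge E -> A) (v : vert F) :
  \sum_(e \in out_edges v) g (val e) = \sum_(e \in out_edges (val v)) g e.
Proof.
symmetry; apply: reindex_fsbig; split=> [e <- //|e f _ _|e ev].
  exact: val_inj.
have Xe : src e \in X by rewrite ev; apply: valP.
by exists (exist _ e Xe) => //; apply: val_inj.
Qed.

Lemma restrict_regular (v : vert F) : regular v -> regular (val v).
Proof. by move=> [[e <-] _]; split=> //; exists (val e). Qed.

Lemma incl_family_subproof : is_leavitt_family
  (fun v : vert F => lvert R (val v)) (fun e : edge F => ledge R (val e))
  (fun e : edge F => lghost R (val e)).
Proof.
split=> [v w|e|e|e f|v vreg].
- by rewrite lvertM val_eqE.
- by rewrite lvert_edge ledge_vert.
- by rewrite lvert_ghost lghost_vert.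
- by rewrite lghost_edge val_eqE.
rewrite (restrict_sum (fun e => ledge R e ** lghost R e)) fsbig_finite; last exact: rfE.
by rewrite lvert_reg //; apply: restrict_regular.
Qed.

Definition incl_family := LeavittFamily incl_family_subproof.
Definition incl := leavitt_lift incl_family.

Lemma incl_hom : nualg_hom incl. Proof. exact: leavitt_lift_hom. Qed.

Lemma incl_deg k x : leavitt_deg k x -> leavitt_deg k (incl x).
Proof.
have ih := incl_hom.
elim/leavitt_deg_ind => {x} [|x y hx hy|a v s w t _ _ <-].
- by rewrite (nualg_hom0 ih); apply: leavitt_deg0.
- by rewrite (nualg_homD ih); apply: leavitt_degD.
rewrite (nualg_homZ ih) (nualg_homM ih); apply/leavitt_degZ/leavitt_degM.
  elim: s v => [|e s IH] v /=; first
    by rewrite /incl leavitt_lift_vert; apply: leavitt_deg_vert.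
  rewrite (nualg_homM ih) intS; apply: leavitt_degM (IH _).
  by rewrite /incl leavitt_lift_edge; apply: leavitt_deg_edge.
elim: t w => [|e t IH] w /=; first
  by rewrite /incl leavitt_lift_vert; apply: leavitt_deg_vert.
rewrite (nualg_homM ih) intS opprD addrC; apply: leavitt_degM (IH _) _.
by rewrite /incl leavitt_lift_ghost; apply: leavitt_deg_ghost.
Qed.

(** The inclusion preserves degrees, and vertices of E have no torsion, so graded
    uniqueness applies to its kernel. *)
Lemma incl_inj : injective incl.
Proof.
have ih := incl_hom.
suff ker0 x : incl x = 0 -> x = 0.
  move=> x y xy; apply/eqP; rewrite -subr_eq0; apply/eqP/ker0.
  by rewrite (nualg_homB ih) xy subrr.
move=> x0.
have [s [f [us fdeg _ xE]]] := homog_gen_components (I := setT) Logic.I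
  (fun _ _ _ _ => Logic.I) (homog_genT x).
suff f0 k : k \in s -> f k = 0 by rewrite xE big_seq big1.
move=> ks.
have fk0 : incl (f k) = 0.
  apply: (homogeneous_indep us (f := fun k => incl (f k))) => // [j|].
    by apply: incl_deg; case: (fdeg j).
  by rewrite -(nualg_hom_sum ih) -xE.
apply: (@graded_uniqueness _ _ (Ideal (@is_ideal0 (leavitt R F)))
  (Ideal (is_ideal_ker ih)) restrict_row_finite _ k) => //; last by case: (fdeg k).
move=> a v a0 /=; rewrite (nualg_homZ ih) /incl leavitt_lift_vert.
by move=> /(scale_lvert_eq0 rfE) aE; rewrite aE eqxx in a0.
Qed.

(** With p the formal sum of the vertices in X, [right_corner] is L p and
    [left_corner] is p L. *)
Definition right_corner : set L := [set x | forall v, ~ X v -> x ** lvert R v = 0].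
Definition left_corner : set L := [set x | forall v, ~ X v -> lvert R v ** x = 0].

Lemma vert_right_corner v : X v -> right_corner (lvert R v).
Proof. by move=> Xv w Xw; rewrite lvertM; case: eqP => // vw; case: Xw; rewrite -vw. Qed.
Lemma vert_left_corner v : X v -> left_corner (lvert R v).
Proof. by move=> Xv w Xw; rewrite lvertM; case: eqP => // vw; case: Xw; rewrite vw. Qed.

Lemma right_corner_sum x : right_corner x ->
  exists2 s : seq (vert E), x = \sum_(v <- s) x ** lvert R v
    & forall v, v \in s -> X v.
Proof.
move=> xc; have [s xE] := leavitt_sum_right x.
exists [seq v <- s | v \in X]; last by move=> v; rewrite mem_filter => /andP[/set_mem].
rewrite big_filter big_mkcond {1}xE; apply: eq_bigr => v _.
by case: ifPn => // /negP Xv; apply: xc => Xv'; apply/Xv/mem_set.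
Qed.

Lemma left_corner_sum x : left_corner x ->
  exists2 s : seq (vert E), x = \sum_(v <- s) lvert R v ** x
    & forall v, v \in s -> X v.
Proof.
move=> xc; have [s xE] := leavitt_sum_left x.
exists [seq v <- s | v \in X]; last by move=> v; rewrite mem_filter => /andP[/set_mem].
rewrite big_filter big_mkcond {1}xE; apply: eq_bigr => v _.
by case: ifPn => // /negP Xv; apply: xc => Xv'; apply/Xv/mem_set.
Qed.

Lemma incl_vert v : X v -> exists y : leavitt R F, incl y = lvert R v.
Proof.
move=> Xv; exists (lvert R (exist _ v (mem_set Xv) : vert F)).
exact: leavitt_lift_vert.
Qed.

Lemma incl_walk_elt v s : X v -> walk v s ->
  exists y : leavitt R F, incl y = walk_elt R v s.
Proof.
elim: s v => [|e s IH] v Xv /=; first by move=> _; apply: incl_vert.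
move=> /andP[/eqP ev w]; rewrite -ev in Xv.
have [y <-] := IH _ (hX Xv) w.
exists (ledge R (exist _ e (mem_set Xv) : edge F) ** y).
by rewrite (nualg_homM incl_hom) /incl leavitt_lift_edge.
Qed.

Lemma incl_walk_star v s : X v -> walk v s ->
  exists y : leavitt R F, incl y = walk_star R v s.
Proof.
elim: s v => [|e s IH] v Xv /=; first by move=> _; apply: incl_vert.
move=> /andP[/eqP ev w]; rewrite -ev in Xv.
have [y <-] := IH _ (hX Xv) w.
exists (y ** lghost R (exist _ e (mem_set Xv) : edge F)).
by rewrite (nualg_homM incl_hom) /incl leavitt_lift_ghost.
Qed.

(** A monomial survives between v and w only when its two paths start at v and
    w, and paths that start in X stay in X. *)
Lemma incl_corner v w x : X v -> X w ->
  exists y : leavitt R F, incl y = lvert R v ** x ** lvert R w.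
Proof.
move=> Xv Xw; have ih := incl_hom.
elim: (homog_genT x) => [|y z [_ [k yk]] _ [u uE]].
  by exists 0; rewrite (nualg_hom0 ih) numulr0 numul0r.
rewrite numulDr numulDl -uE.
suff [u' <-] : exists u', incl u' = lvert R v ** y ** lvert R w.
  by exists (u' + u); rewrite (nualg_homD ih).
elim/leavitt_deg_ind: yk => [|{}x {}y [a aE] [b bE]|a v' s w' t vs wt _].
- by exists 0; rewrite (nualg_hom0 ih) numulr0 numul0r.
- by exists (a + b); rewrite (nualg_homD ih) aE bE numulDr numulDl.
rewrite -nuscaleAr -nuscaleAl !numulA lvert_walk_elt // -numulA walk_star_vertM //.
case: eqP => [vv|_]; last first.
  by exists 0; rewrite (nualg_hom0 ih) numul0r scaler0.
case: eqP => [ww|_]; last by exists 0; rewrite (nualg_hom0 ih) numulr0 scaler0.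
rewrite -vv in vs *; rewrite ww in wt *.
have [p <-] := incl_walk_elt Xv vs; have [q <-] := incl_walk_star Xw wt.
by exists (a *: (p ** q)); rewrite (nualg_homZ ih) (nualg_homM ih).
Qed.

Lemma incl_left_corner (s : leavitt R F) : left_corner (incl s).
Proof.
move=> v Xv; have [t ->] := leavitt_sum_left s.
rewrite (nualg_hom_sum incl_hom) numul_sumr big1 // => w _.
rewrite (nualg_homM incl_hom) {1}/incl leavitt_lift_vert /= numulA lvertM.
by case: eqP => [vw|_]; [case: Xv; rewrite vw; apply/set_mem; apply: valP|apply: numul0r].
Qed.

Lemma incl_right_corner (s : leavitt R F) : right_corner (incl s).
Proof.
move=> v Xv; have [t ->] := leavitt_sum_right s.
rewrite (nualg_hom_sum incl_hom) numul_suml big1 // => w _.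
rewrite (nualg_homM incl_hom) {2}/incl leavitt_lift_vert /= -numulA lvertM.
case: eqP => [vw|_]; last exact: numulr0.
by case: Xv; rewrite -vw; apply/set_mem; apply: valP.
Qed.

Lemma incl_image x : left_corner x -> right_corner x ->
  exists y : leavitt R F, incl y = x.
Proof.
move=> xl xr; have ih := incl_hom.
have [s xE sX] := left_corner_sum xl; have [t xE' tX] := right_corner_sum xr.
have incl_sum (r : seq (vert E)) (g : vert E -> L) :
    (forall v, v \in r -> exists y : leavitt R F, incl y = g v) ->
    exists y : leavitt R F, incl y = \sum_(v <- r) g v.
  elim: r => [|v r IH] h; first by exists 0; rewrite big_nil (nualg_hom0 ih).
  have [y yE] := h v (mem_head _ _).
  have [z zE] : exists z, incl z = \sum_(v <- r) g v.
    by apply: IH => w wr; apply: h; rewrite inE wr orbT.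
  by exists (y + z); rewrite big_cons (nualg_homD ih) yE zE.
rewrite xE; apply: (incl_sum) => v /sX Xv; rewrite xE' numul_sumr.
by apply: incl_sum => w /tX Xw; rewrite numulA; apply: incl_corner.
Qed.

Lemma right_corner_ideal x : right_corner x -> ideal_set I x.
Proof.
move=> /right_corner_sum[s -> sX]; apply: ideal_sum_seq => v /sX Xv.
by apply: ideal_mull; apply: mem_vert_ideal.
Qed.

Lemma right_corner_mull a x : right_corner x -> right_corner (a ** x).
Proof. by move=> xc v Xv; rewrite -numulA xc // numulr0. Qed.
Lemma left_corner_mulr a x : left_corner x -> left_corner (x ** a).
Proof. by move=> xc v Xv; rewrite numulA xc // numul0r. Qed.
Lemma right_cornerB x y : right_corner x -> right_corner y -> right_corner (x - y).
Proof. by move=> xc yc v Xv; rewrite numulDl numulNr xc // yc // subr0. Qed.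
Lemma left_cornerB x y : left_corner x -> left_corner y -> left_corner (x - y).
Proof. by move=> xc yc v Xv; rewrite numulDr numulrN xc // yc // subr0. Qed.

Definition right_bimod : subbimod (ideal_ring I) (leavitt R F) L.
Proof.
apply: (@SubBimod _ _ _ right_corner (@ideal_val _ I) incl) => //.
- by move=> v _; apply: numul0r.
- exact: right_cornerB.
- exact: nualg_homD incl_hom.
- exact: nualg_homM incl_hom.
- by move=> t x; apply: right_corner_mull.
- by move=> x s _; apply/right_corner_mull/incl_right_corner.
Defined.

Definition left_bimod : subbimod (leavitt R F) (ideal_ring I) L.
Proof.
apply: (@SubBimod _ _ _ left_corner incl (@ideal_val _ I)) => //.
- by move=> v _; apply: numulr0.
- exact: left_cornerB.
- exact: nualg_homD incl_hom.
- exact: nualg_homM incl_hom.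
- by move=> s x _; apply/left_corner_mulr/incl_left_corner.
- by move=> x t; apply: left_corner_mulr.
Defined.

(** The span of the products is an ideal, and contains each v = v v in X. *)
Lemma ideal_span x : ideal_set I x -> addspan [set y | exists m n,
  [/\ right_corner m, left_corner n & y = m ** n]] x.
Proof.
move: x; apply: vert_ideal_sub => [|v Xv]; last first.
  apply: addspan1; exists (lvert R v), (lvert R v).
  by split; [apply: vert_right_corner|apply: vert_left_corner|rewrite lvertMid].
split=> [|x y xs ys|a x|x a].
- exact: AddSpan0.
- apply: addspan_add => //; move: y ys; apply: addspan_morph => [x' y|].
    exact: opprD.
  move=> _ [m [n [mc nc ->]]]; apply: addspan1; exists (- m), n; split=> //.
    by move=> v Xv; rewrite numulNr mc // oppr0.
  by rewrite numulNr.
- move: x; apply: addspan_morph => [x y|]; first exact: numulDr.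
  move=> _ [m [n [mc nc ->]]]; apply: addspan1; exists (a ** m), n.
  by rewrite numulA; split=> //; apply: right_corner_mull.
- move: x; apply: (@addspan_morph _ _ _ _ (fun x => x ** a)) => [x y|].
    exact: numulDl.
  move=> _ [m [n [mc nc ->]]]; apply: addspan1; exists m, (n ** a).
  by rewrite numulA; split=> //; apply: left_corner_mulr.
Qed.

(** The context consists of L p and p L: their product spans the ideal, and
    p L p is the algebra of the restricted graph. *)
Lemma restrict_morita : morita_equivalent (ideal_ring I) (leavitt R F).
Proof.
apply: (@corner_morita _ _ _ right_bimod left_bimod) => //=.
- exact: val_inj.
- exact: incl_inj.
- move=> m n mc nc.
  have Imn : m ** n \in ideal_pred I.
    by apply/ideal_predP; apply: ideal_mulr; apply: right_corner_ideal.
  by exists (IdealRing Imn).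
- move=> n m nc mc; apply: incl_image; first exact: left_corner_mulr.
  exact: right_corner_mull.
- by move=> t; apply/ideal_span/ideal_predP/ideal_valP.
- move=> s; have [r -> rX] := left_corner_sum (incl_left_corner s).
  apply: addspan_sum => v /rX Xv; apply: addspan1; exists (lvert R v), (incl s).
  by split=> //; [apply: vert_left_corner|apply: incl_right_corner].
- move=> m mc; have [r mE rX] := right_corner_sum mc.
  rewrite mE; apply: addspan_sum => v /rX Xv; apply: addspan1.
  exists m, (lvert R v), (lvert R v); rewrite -numulA lvertMid.
  by split=> //; [apply: vert_left_corner|apply: vert_right_corner].
- move=> n nc; have [r nE rX] := left_corner_sum nc.
  rewrite nE; apply: addspan_sum => v /rX Xv; apply: addspan1.
  exists (lvert R v), (lvert R v), n; rewrite lvertMid.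
  by split=> //; [apply: vert_left_corner|apply: vert_right_corner].
Qed.

End RestrictedGraph.

(** * Saturated hereditary sets and ideals *)

Theorem theorem7p9 (R : comNzRingType) (E : graph) (rfE : row_finite E) :
  [/\ [/\ set_lattice (@saturated_hereditary E)
            setI (fun H1 H2 => saturation (H1 `|` H2)),
          set_lattice (@graded_basic_ideal R E) setI (@ideal_sum R E),
          set_lattice_iso
            (@saturated_hereditary E)
            setI (fun H1 H2 => saturation (H1 `|` H2))
            (@graded_basic_ideal R E) setI (@ideal_sum R E)
            (fun H => ideal_set (vert_ideal R H))
        & forall H1 H2 : set (vert E),
            saturated_hereditary H1 -> saturated_hereditary H2 ->
            ideal_set (vert_ideal R H1) `&` ideal_set (vert_ideal R H2)
              = ideal_set (vert_ideal R (H1 `&` H2)) /\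
            ideal_sum (ideal_set (vert_ideal R H1)) (ideal_set (vert_ideal R H2))
              = ideal_set (vert_ideal R (saturation (H1 `|` H2)))],
      forall (H : set (vert E)) (hH : saturated_hereditary H),
        exists phi : leavitt R (graph_remove (proj1 hH)) ->
                     leavitt_quot (vert_ideal R H),
          [/\ nualg_hom phi,
              bijective phi,
              forall v, phi (lvert R v)
                = leavitt_proj (vert_ideal R H) (lvert R (val v)),
              forall e, phi (ledge R e)
                = leavitt_proj (vert_ideal R H) (ledge R (val e))
            & forall e, phi (lghost R e)
                = leavitt_proj (vert_ideal R H) (lghost R (val e))]
    & forall (X : set (vert E)) (hX : hereditary X),
        morita_equivalent (ideal_ring (vert_ideal R X))
                          (leavitt R (graph_restrict hX))].
Proof.
split; last by move=> X hX; apply: restrict_morita.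
  split.
  - exact: saturated_hereditary_lattice.
  - exact: graded_basic_lattice.
  - exact: vert_ideal_lattice_iso.
  - by move=> H1 H2 h1 h2; split; [apply: vert_idealI|apply: vert_ideal_sum].
by move=> H hH; apply: quot_removeP.
Qed.
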